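(* Let $0<a\le b<1$ and let $f_0\colon[0,b]\to[0,1]$ and $f_1\colon[a,1]\to[0,1]$ be a fixed pair of branch functions. For $p\in[a,b]$ let $T_p^{\pm}$ be the upper and lower Lorenz maps with point of discontinuity $p$ built from $f_0,f_1$, and let $h(T_p)$ be their common topological entropy. Then the map $p\mapsto h(T_p)$ is continuous on $[a,b]$.
   Context: Branch functions: given $0<a\le b<1$, a pair of branch functions is a pair $f_0\colon[0,b]\to[0,1]$, $f_1\colon[a,1]\to[0,1]$ of continuous, strictly increasing, surjective functions for which there exist constants $C,c>1$ with $C^{-1}|x-y|\le|f_i^{-1}(x)-f_i^{-1}(y)|\le c^{-1}|x-y|$ for $i\in\{0,1\}$ and all $x,y\in[0,1]$. Lorenz maps: for $p\in[a,b]$, the upper Lorenz map $T_p^+\colon[0,1]\to[0,1]$ is $T_p^+(x)=f_0(x)$ if $0\le x<p$ and $T_p^+(x)=f_1(x)$ if $p\le x\le1$; the lower Lorenz map $T_p^-\colon[0,1]\to[0,1]$ is $T_p^-(x)=f_0(x)$ if $0\le x\le p$ and $T_p^-(x)=f_1(x)$ if $p<x\le1$. Topological entropy: for a piecewise monotonic map $T\colon[0,1]\to[0,1]$ (such as a Lorenz map), $h(T):=\lim_{n\to\infty}\frac1n\ln(\operatorname{Var}(T^n))$, where $T^n$ is the $n$-fold composition and $\operatorname{Var}(f)$ denotes the total variation of $f$ on $[0,1]$. One has $h(T_p^+)=h(T_p^-)$, and $h(T_p)$ denotes this common value. *)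

(* Defs.v *)
From HB Require Import structures.
From mathcomp Require Import all_boot all_order all_algebra.
From mathcomp Require Import all_classical all_reals all_analysis.
Set Implicit Arguments.
Unset Strict Implicit.
Unset Printing Implicit Defensive.
Import Order.TTheory GRing.Theory Num.Theory.
Import numFieldNormedType.Exports.
Local Open Scope classical_set_scope.
Local Open Scope ring_scope.

(* Maps between intervals are total functions R -> R, of which only the values
   on the stated domain are constrained or used. *)

Definition increasing_surjection (R : realType) (u v : R) (f : R -> R) : Prop :=
  [/\ set_fun `[u, v] `[0, 1] f,
      set_surj `[u, v] `[0, 1] f,
      {within `[u, v], continuous f} &
      {in `[u, v] &, {homo f : x y / x < y}}].

(* For f as above, pinv `[u, v] f is the inverse [0, 1] -> [u, v] of f. *)
Definition inverse_bounds (R : realType) (C c u v : R) (f : R -> R) : Prop :=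
  forall x y : R, x \in `[0, 1] -> y \in `[0, 1] ->
    C^-1 * `|x - y| <= `|pinv `[u, v] f x - pinv `[u, v] f y| <= c^-1 * `|x - y|.

Definition branch_functions (R : realType) (a b : R) (f0 f1 : R -> R) : Prop :=
  [/\ increasing_surjection 0 b f0,
      increasing_surjection a 1 f1 &
      exists C c : R, [/\ 1 < C, 1 < c,
        inverse_bounds C c 0 b f0 & inverse_bounds C c a 1 f1]].

Definition upper_lorenz (R : realType) (f0 f1 : R -> R) (p : R) : R -> R :=
  fun x => if x < p then f0 x else f1 x.

Definition lower_lorenz (R : realType) (f0 f1 : R -> R) (p : R) : R -> R :=
  fun x => if x <= p then f0 x else f1 x.

(* The total variation is extended-real valued, hence so are the logarithm lne
   and the limit.  The junk value at n = 0 does not affect the limit. *)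
Definition log_variation_rate (R : realType) (T : R -> R) (n : nat) : \bar R :=
  ((n%:R^-1)%:E * lne (total_variation 0 1 (iter n T)))%E.

Definition topological_entropy (R : realType) (T : R -> R) : \bar R :=
  limn (log_variation_rate T).

(* Main.v *)
(* The branches expand, so that a lap (interval of continuity) of T_p^n with a short
   image splits into at most two pieces in a bounded number of steps while the total
   length of the images grows exponentially.  Hence the variation of T_p^n is
   comparable to the number of laps, which is submultiplicative and does not
   depend on the value of the map at p; this gives the limit and its independence
   of the sign.

   The laps are counted through the visits to p.  Their generating function is a
   multiple of psi_t(u) = sum_k t^k [T_p^k u > p], with factor the reciprocal of
   K_p(t) = 1 - t (psi_t(f0 p) - psi_t(f1 p)).  So t < exp(- h(T_p)) implies that
   K_p(t) > 0 and that psi_t is nondecreasing, and conversely these two properties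
   make the generating function converge at t.  When p increases to p0, expansion
   makes the itineraries under T_p^- converge to those under T_p0^-, so K_p -> K_p0
   uniformly on compact subsets of [0, 1).  Positivity of K_p0 up to
   t < exp(- h(T_p0)) then passes to nearby p, which bounds h(T_p) from above.  If
   h(T_p) were too small for p close to p0, both properties would pass to the limit
   for t in an interval on the right of exp(- h(T_p0)), except that K_p0 could
   vanish there; but K_p0 is a power series with K_p0(0) = 1.  Reflecting the
   interval yields continuity from the right. *)
Require Import Defs.
From mathcomp Require Import all_boot all_order all_algebra.
From mathcomp Require Import all_classical all_reals all_analysis.
From mathcomp Require Import ring lra.
Set Implicit Arguments.
Unset Strict Implicit.
Unset Printing Implicit Defensive.
Import Order.TTheory GRing.Theory Num.Theory.
Import numFieldNormedType.Exports.
Local Open Scope classical_set_scope.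
Local Open Scope ring_scope.

(** * Power series with bounded coefficients *)

Section PowerSeries.
Variable R : realType.
Implicit Types (c d x : nat -> R) (s t A : R).

Definition psum c t : R := limn (series (fun k => c k * t ^+ k)).

Lemma is_cvg_psum c t A : 0 <= t < 1 -> (forall k, `|c k| <= A) ->
  cvgn (series (fun k => c k * t ^+ k)).
Proof.
move=> /andP[t0 t1] cA; apply: normed_cvg.
apply: (@series_le_cvg _ _ (geometric A t)).
- by move=> n; exact: normr_ge0.
- by move=> n; rewrite /= mulr_ge0 ?exprn_ge0// (le_trans _ (cA 0%N)).
- by move=> n /=; rewrite normrM normrX (ger0_norm t0) ler_wpM2r ?exprn_ge0.
- by apply: is_cvg_geometric_series; rewrite ger0_norm.
Qed.

Lemma psum_shift c t A : 0 <= t < 1 -> (forall k, `|c k| <= A) ->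
  psum c t = c 0%N + t * psum (fun k => c k.+1) t.
Proof.
move=> t01 cA.
have cv1 : cvgn (series (fun k => c k.+1 * t ^+ k)).
  by apply: is_cvg_psum t01 _ => k; exact: cA.
apply/cvg_lim => //; rewrite -(cvg_shiftS _).
have -> : (fun n => series (fun k => c k * t ^+ k) n.+1) =
   (fun n => c 0%N + t * series (fun k => c k.+1 * t ^+ k) n).
  apply/funext => n; rewrite /series /= big_nat_recl// expr0 mulr1; congr (_ + _).
  by rewrite mulr_sumr; apply: eq_bigr => i _; rewrite exprS mulrCA.
by apply: cvgD; [exact: cvg_cst|apply: cvgMr].
Qed.

Lemma geometric_sum_le t n : 0 <= t < 1 -> \sum_(i < n) t ^+ i <= (1 - t)^-1.
Proof.
move=> /andP[t0 t1]; rewrite -[leRHS]mul1r ler_pdivlMr ?subr_gt0//.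
have := subrX1 t n; set S := \sum_(i < n) _ => E.
have -> : S * (1 - t) = 1 - t ^+ n by rewrite -(opprB (t ^+ n)) E; ring.
by rewrite gerBl exprn_ge0.
Qed.

Lemma psum_bound c t A : 0 <= t < 1 -> (forall k, `|c k| <= A) ->
  `|psum c t| <= A / (1 - t).
Proof.
move=> t01 cA; have cv := is_cvg_psum t01 cA.
move/andP: t01 => [t0 t1].
rewrite -lim_norm//; apply: limr_le; first exact: is_cvg_norm.
near=> n; apply: le_trans (ler_norm_sum _ _ _) _.
apply: (@le_trans _ _ (\sum_(0 <= i < n) A * t ^+ i)).
  by apply: ler_sum => i _; rewrite normrM normrX (ger0_norm t0) ler_wpM2r ?exprn_ge0.
by rewrite -mulr_sumr big_mkord ler_wpM2l ?geometric_sum_le ?t0// (le_trans _ (cA 0%N)).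
Unshelve. all: by end_near. Qed.

Lemma psumB c d t A : 0 <= t < 1 -> (forall k, `|c k| <= A) -> (forall k, `|d k| <= A) ->
  psum (fun k => c k - d k) t = psum c t - psum d t.
Proof.
move=> t01 cA dA; apply/cvg_lim => //.
have -> : series (fun k => (c k - d k) * t ^+ k) =
    series (fun k => c k * t ^+ k) \- series (fun k => d k * t ^+ k).
  apply/funext => n; rewrite /series /= -sumrB.
  by apply: eq_bigr => i _; rewrite mulrBl.
by apply: cvgB; [exact: is_cvg_psum cA|exact: is_cvg_psum dA].
Qed.

Lemma exp_lt_eps t e : 0 <= t < 1 -> 0 < e -> exists N, t ^+ N < e.
Proof.
move=> /andP[t0 t1] e0; have /cvgrPdist_lt/(_ e e0)[N _ H] := @cvg_expr R t (ltac:(by rewrite ger0_norm)).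
exists N; have := H N (leqnn N); rewrite sub0r normrN ger0_norm//; exact: exprn_ge0.
Qed.

(** The recursion multiplies the distance from [x k] to the tail sum by [t], and these distances are
    bounded, so they vanish. This identifies bounded solutions of a functional equation along an
    orbit. *)
Lemma psum_unique c x t A B : 0 <= t < 1 -> (forall k, `|c k| <= A) ->
  (forall k, `|x k| <= B) -> (forall k, x k = c k + t * x k.+1) ->
  x 0%N = psum c t.
Proof.
move=> t01 cA xB xE.
have t0 : 0 <= t by case/andP: t01.
pose E := B + A / (1 - t).
have H n : forall k, `|x k - psum (fun j => c (k + j)%N) t| <= t ^+ n * E.
  elim: n => [|n IH] k.
    rewrite mul1r; apply: le_trans (ler_normB _ _) _; apply: lerD => //.
    exact: psum_bound.
  have -> : x k - psum (fun j => c (k + j)%N) t =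
     t * (x k.+1 - psum (fun j => c (k.+1 + j)%N) t).
    rewrite {1}xE (psum_shift t01 (fun j => cA (k + j)%N)) addn0.
    have -> : (fun j => c (k.+1 + j)%N) = (fun j => c (k + j.+1)%N).
      by apply/funext => j; rewrite addSnnS.
    ring.
  by rewrite normrM ger0_norm// exprS -mulrA ler_wpM2l.
have E0 : 0 <= E by have := H 0%N 0%N; rewrite mul1r; apply: le_trans.
apply/eqP; rewrite -subr_eq0 -normr_le0; apply/ler_addgt0Pl => e e0; rewrite addr0.
have [N HN] := exp_lt_eps t01 (divr_gt0 e0 (ltr_pwDr ltr01 E0)).
apply: le_trans (H N 0%N) _.
apply: (@le_trans _ _ (t ^+ N * (E + 1))).
  by rewrite ler_wpM2l ?exprn_ge0// lerDl.
by rewrite -ler_pdivlMr ?ltW// ltr_wpDl.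
Qed.

Lemma psum_tail c d t N : 0 <= t < 1 -> (forall k, 0 <= c k <= 1) ->
  (forall k, 0 <= d k <= 1) -> (forall k, (k < N)%N -> c k = d k) ->
  `|psum c t - psum d t| <= t ^+ N / (1 - t).
Proof.
move=> t01; elim: N c d => [|N IH] c d c01 d01 cd.
  (* Both sums lie between 0 and [1 / (1 - t)], so no factor 2 is lost. *)
  have t1 : 0 < 1 - t by case/andP: t01; rewrite subr_gt0.
  have bd (z : nat -> R) : (forall k, 0 <= z k <= 1) -> 0 <= psum z t <= 1 / (1 - t).
    move=> z01; have zb k : `|z k| <= 1 by rewrite ger0_norm; case/andP: (z01 k).
    apply/andP; split; last exact: le_trans (ler_norm _) (psum_bound t01 zb).
    apply: limr_ge; first exact: is_cvg_psum zb.
    near=> n; rewrite /series /=; apply: sumr_ge0 => i _.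
    by rewrite mulr_ge0 ?exprn_ge0//; [case/andP: (z01 i)|case/andP: t01].
  have := bd _ c01; have := bd _ d01; rewrite expr0 ler_norml; lra.
have nb (z : nat -> R) : (forall k, 0 <= z k <= 1) -> forall k, `|z k| <= 1.
  by move=> z01 k; rewrite ger0_norm; case/andP: (z01 k).
rewrite (psum_shift t01 (nb _ c01)) (psum_shift t01 (nb _ d01)) cd// opprD addrACA subrr add0r.
rewrite -mulrBr normrM ger0_norm; last by case/andP: t01.
rewrite exprS -mulrA ler_wpM2l//; first by case/andP: t01.
by apply: IH => // k kN; exact: cd.
Unshelve. all: by end_near. Qed.

(* Coefficients of the quotient of [psum c t - psum c s] by [t - s]. *)
Definition divcoef s c : nat -> R := fun j => psum (fun k => c (j.+1 + k)%N) s.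

Lemma divcoef_bound s c A : 0 <= s < 1 -> (forall k, `|c k| <= A) ->
  forall j, `|divcoef s c j| <= A / (1 - s).
Proof. by move=> s01 cA j; exact: psum_bound. Qed.

(** Both sides solve the recursion of [psum_unique] with coefficients [(t - s) * divcoef s c k], the
    left one through the differences of the tail sums at [t] and at [s]. *)
Lemma divcoefP s c t A : 0 <= s < 1 -> 0 <= t < 1 -> (forall k, `|c k| <= A) ->
  psum c t - psum c s = (t - s) * psum (divcoef s c) t.
Proof.
move=> s01 t01 cA.
have dA := divcoef_bound s01 cA.
pose x k := psum (fun j => c (k + j)%N) t; pose y k := psum (fun j => c (k + j)%N) s.
have sh r k : 0 <= r < 1 ->
    psum (fun j => c (k + j)%N) r = c k + r * psum (fun j => c (k.+1 + j)%N) r.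
  move=> r01; rewrite (psum_shift r01 (fun j => cA (k + j)%N)) addn0.
  have -> // : (fun j => c (k.+1 + j)%N) = (fun j => c (k + j.+1)%N).
  by apply/funext => j; rewrite addSnnS.
have eq1 : psum c t - psum c s = psum (fun k => (t - s) * divcoef s c k) t.
  apply: (@psum_unique _ (fun k => x k - y k) _ (`|t - s| * (A / (1 - s)))
     (A / (1 - t) + A / (1 - s)) t01).
  - by move=> k; rewrite normrM ler_wpM2l.
  - move=> k; apply: le_trans (ler_normB _ _) _.
    by apply: lerD; apply: psum_bound.
  - by move=> k; rewrite /x /y (sh t)// (sh s k)// /divcoef; ring.
rewrite eq1; apply/esym.
apply: (@psum_unique _ (fun k => (t - s) * psum (fun j => divcoef s c (k + j)%N) t) _
  (`|t - s| * (A / (1 - s))) (`|t - s| * (A / (1 - s) / (1 - t))) t01).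
- by move=> k; rewrite normrM ler_wpM2l.
- by move=> k; rewrite normrM ler_wpM2l//; apply: psum_bound.
- move=> k; rewrite (psum_shift t01 (fun j => dA (k + j)%N)) addn0.
  have -> : (fun j => divcoef s c (k.+1 + j)%N) = (fun j => divcoef s c (k + j.+1)%N).
    by apply/funext => j; rewrite addSnnS.
  ring.
Qed.

(* All the quotients by powers of [t - s] vanish at [s], and dividing [n] times only
   multiplies the bound on the coefficients by [(1 - s) ^- n]. *)
Lemma psum_eq0_near c A s t1 t2 : 0 <= s < 1 -> t1 < s < t2 ->
  (forall k, `|c k| <= A) ->
  (forall t, 0 <= t < 1 -> t1 < t < t2 -> psum c t = 0) ->
  forall t, 0 <= t < 1 -> `|t - s| < 1 - s -> psum c t = 0.
Proof.
move=> s01 s12 cA c0 t t01 ts.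
have s1 : 0 < 1 - s by case/andP: s01; rewrite subr_gt0.
have tt1 : 0 < 1 - t by case/andP: t01; rewrite subr_gt0.
pose q := `|t - s| / (1 - s).
have H n : forall (d : nat -> R) B, (forall k, `|d k| <= B) ->
    (forall r, 0 <= r < 1 -> t1 < r < t2 -> psum d r = 0) ->
    `|psum d t| <= q ^+ n * (B / (1 - t)).
  elim: n => [|n IH] d B dB d0; first by rewrite mul1r; exact: psum_bound.
  have dv := divcoef_bound s01 dB.
  have E r : 0 <= r < 1 -> psum d r = (r - s) * psum (divcoef s d) r.
    by move=> r01; rewrite -(divcoefP s01 r01 dB) (d0 s)// subr0.
  have eb : forall k, `|divcoef s (divcoef s d) k| <= B / (1 - s) / (1 - s).
    exact: divcoef_bound.
  have dv0 r : 0 <= r < 1 -> t1 < r < t2 -> r != s -> psum (divcoef s d) r = 0.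
    move=> r01 r12 rs; have := E r r01; rewrite d0// => /esym/eqP.
    by rewrite mulf_eq0 subr_eq0 (negbTE rs) => /eqP.
  have dvs : psum (divcoef s d) s = 0.
    apply/eqP; rewrite -normr_le0; apply/ler_addgt0Pl => e e0; rewrite addr0.
    have B0 : 0 <= B by apply: le_trans (dB 0%N).
    pose M := B / (1 - s) / (1 - s).
    have M0 : 0 <= M by rewrite !divr_ge0// ltW.
    (* The three bounds keep [1 - (s + m)] at least [(1 - s) / 2], keep [s + m] below [t2], and make
       the error at most [e]. *)
    pose m := Num.min ((1 - s) / 2) (Num.min ((t2 - s) / 2) (e * (1 - s) / 2 / (M + 1))).
    have m0 : 0 < m.
      have /andP[_ st2] := s12.
      have M1 : 0 < M + 1 by rewrite ltr_wpDl.
      rewrite !lt_min; apply/and3P; split; [lra|lra|].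
      by rewrite divr_gt0// divr_gt0// mulr_gt0.
    have m1 : m <= (1 - s) / 2 by rewrite ge_min lexx.
    have m2 : m <= (t2 - s) / 2 by rewrite !ge_min lexx orbT.
    have m3 : m <= e * (1 - s) / 2 / (M + 1) by rewrite !ge_min lexx !orbT.
    have r01 : 0 <= s + m < 1 by case/andP: s01 => *; apply/andP; split; lra.
    have r12 : t1 < s + m < t2 by case/andP: s12 => *; apply/andP; split; lra.
    have := divcoefP s01 r01 dv; rewrite (dv0 _ r01 r12); last by rewrite -subr_eq0; apply: lt0r_neq0; lra.
    rewrite sub0r => /(congr1 Num.norm); rewrite normrN normrM => ->.
    have -> : s + m - s = m by ring.
    rewrite (gtr0_norm m0).
    have := psum_bound r01 eb; rewrite -/M => Hb.
    apply: le_trans (ler_wpM2l (ltW m0) Hb) _.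
    have g : (1 - s) / 2 <= 1 - (s + m) by lra.
    apply: (@le_trans _ _ (m * (M / ((1 - s) / 2)))).
      apply: ler_wpM2l; first exact: ltW.
      by apply: ler_wpM2l => //; rewrite lef_pV2 ?posrE//; lra.
    apply: (@le_trans _ _ (m * ((M + 1) / ((1 - s) / 2)))).
      by apply: ler_wpM2l; [exact: ltW|apply: ler_wpM2r; [rewrite invr_ge0; lra|lra]].
    move: m3; rewrite ler_pdivlMr; last by rewrite ltr_wpDl.
    move=> m3; rewrite mulrA ler_pdivrMr; last lra.
    by apply: le_trans m3 _; lra.
  rewrite E// normrM exprS.
  have := IH _ _ dv (fun r r01 r12 => ltac:(have [->//|rs] := eqVneq r s; exact: dv0)).
  move=> /(ler_wpM2l (normr_ge0 (t - s))) /le_trans; apply.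
  by rewrite /q le_eqVlt; apply/orP; left; apply/eqP; field; rewrite !gt_eqF.
have q01 : 0 <= q < 1.
  by rewrite /q divr_ge0 ?(ltW s1)//= ltr_pdivrMr// mul1r.
have B0 : 0 <= A / (1 - t) by apply: divr_ge0 (ltW tt1); apply: le_trans (cA 0%N).
apply/eqP; rewrite -normr_le0; apply/ler_addgt0Pl => e e0; rewrite addr0.
have [N HN] := exp_lt_eps q01 (divr_gt0 e0 (ltr_pwDr ltr01 B0)).
apply: le_trans (H N _ _ cA c0) _.
apply: (@le_trans _ _ (q ^+ N * (A / (1 - t) + 1))).
  by rewrite ler_wpM2l ?exprn_ge0 ?lerDl//; case/andP: q01.
by rewrite -ler_pdivlMr ?ltW// ltr_wpDl.
Qed.

(* The interval where the sum vanishes extends to the left, each time doubling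
   [1 - t1]. *)
Lemma psum_eq0_coef0 c A t1 t2 : (forall k, `|c k| <= A) -> t1 < t2 -> 0 < t2 -> t1 < 1 ->
  (forall t, 0 <= t < 1 -> t1 < t < t2 -> psum c t = 0) -> c 0%N = 0.
Proof.
move=> cA t12 t20 t11.
(* After [n] doublings of [1 - t1] the left end is negative, and [c 0] is the sum at 0. *)
have [n Hn] : exists n, 1 < 2 ^+ n * (1 - t1).
  have [N HN] := @exp_lt_eps 2^-1 (1 - t1) (ltac:(by apply/andP; split; lra)) (ltac:(lra)).
  by exists N; rewrite mulrC -ltr_pdivrMr ?exprn_gt0// mul1r -exprVn.
elim: n t1 t12 t11 Hn => [|n IH] t1 t12 t11 Hn c0.
  have := psum_shift (ltac:(by rewrite lexx ltr01) : 0 <= (0:R) < 1) cA; rewrite mul0r addr0.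
  by rewrite c0// ?lexx ?ltr01// t20 andbT; move: Hn; rewrite expr0; lra.
apply: (IH (2 * t1 - 1)); [lra|lra| |].
  by move: Hn; rewrite exprSr -mulrA; congr (_ < _ * _); ring.
move=> t t01 /andP[tl tr].
have [ht|ht] := ltP t1 t; first by apply: c0; rewrite ?ht.
have [t0 tlt1] := andP t01.
(* This centre lies where the sum vanishes, and being below [(1 + t) / 2] it is closer to [t] than
   to 1. *)
pose s := (t1 + Num.min t2 ((1 + t) / 2)) / 2.
have mn1 : Num.min t2 ((1 + t) / 2) <= t2 by rewrite ge_min lexx.
have mn2 : Num.min t2 ((1 + t) / 2) <= (1 + t) / 2 by rewrite ge_min lexx orbT.
have mn3 : t1 < Num.min t2 ((1 + t) / 2) by rewrite lt_min t12; lra.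
apply: (@psum_eq0_near c A s t1 t2) => //.
- by apply/andP; split; rewrite /s; lra.
- by apply/andP; split; rewrite /s; lra.
- by rewrite ler0_norm /s; lra.
Qed.

End PowerSeries.

(** * Growth rate of subadditive sequences *)

Section Fekete.
Variables (R : realType) (x : nat -> R).
Hypothesis x_ge0 : forall n, 0 <= x n.
Hypothesis xD : forall m n, x (m + n)%N <= x m + x n.

(** The limit in Fekete's lemma; the shifted index avoids a division by zero. *)
Definition growth : R := inf (range (fun n => x n.+1 / n.+1%:R)).

Let growth_inf : has_inf (range (fun n => x n.+1 / n.+1%:R)).
Proof.
split; first by exists (x 1 / 1), 0%N.
by exists 0 => _ [n _ <-]; rewrite divr_ge0.
Qed.

Lemma growth_le n : n%:R * growth <= x n.
Proof.
case: n => [|n]; first by rewrite mul0r.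
rewrite mulrC -ler_pdivlMr ?ltr0n//.
by apply: ge_inf; [case: growth_inf|exists n].
Qed.

Lemma growth_ge k : (forall n, n%:R * k <= x n) -> k <= growth.
Proof.
move=> kx; apply: lb_le_inf; first exact: growth_inf.1.
by move=> _ [n _ <-]; rewrite ler_pdivlMr ?ltr0n// mulrC.
Qed.

(** Some ratio [x m.+1 / m.+1] is below [s]. Dividing [n] by [m.+1], the full blocks cost at most
    [n%:R * s + x 0] and the remainder a constant. *)
Lemma growth_upper s : growth < s -> exists B, forall n, x n <= n%:R * s + B.
Proof.
move=> hs; have [_ [m _ <-] ms] := inf_lt growth_inf.1 hs.
have xM k q : x (q * k)%N <= q%:R * x k + x 0.
  elim: q => [|q IH]; first by rewrite mul0r add0r.
  by rewrite mulSn; apply: le_trans (xD _ _) _; rewrite -natr1 mulrDl mul1r; lra.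
have s0 : 0 <= s by apply: le_trans (ltW ms); rewrite divr_ge0.
exists (m.+1%:R * x 1 + x 0 + x 0) => n.
rewrite {1}(divn_eq n m.+1); set q := (n %/ m.+1)%N; set r := (n %% m.+1)%N.
have rm : r%:R <= m.+1%:R :> R by rewrite ler_nat ltnW// ltn_mod.
apply: le_trans (xD _ _) _.
have h1 : x r <= m.+1%:R * x 1 + x 0.
  by rewrite -[r]muln1; apply: le_trans (xM _ _) _; rewrite lerD2r ler_wpM2r.
have h2 : q%:R * x m.+1 <= n%:R * s.
  apply: (@le_trans _ _ ((q * m.+1)%:R * s)).
    by rewrite natrM -mulrA ler_wpM2l// mulrC -ler_pdivrMr ?ltr0n// ltW.
  by rewrite ler_wpM2r// ler_nat leq_trunc_div.
by have := xM m.+1 q; lra.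
Qed.

Lemma growth_cvg : (fun n => n%:R^-1 * x n) @ \oo --> growth.
Proof.
apply/cvgrPdist_le => e e0.
have [B HB] := growth_upper (ltac:(lra) : growth < growth + e / 2).
near=> n.
have n0 : 0 < n%:R :> R by rewrite ltr0n; near: n; exists 1%N.
have nB : B <= n%:R * (e / 2).
  rewrite -ler_pdivrMr ?divr_gt0//; near: n; exact: nbhs_infty_ger.
have l1 : growth <= n%:R^-1 * x n by rewrite mulrC ler_pdivlMr// mulrC growth_le.
rewrite distrC ger0_norm ?subr_ge0// lerBlDr mulrC ler_pdivrMr//.
by have := HB n; lra.
Unshelve. all: by end_near. Qed.

End Fekete.

(** * Laps of Lorenz maps *)

Definition expanding (R : realType) (C c u v : R) (f : R -> R) : Prop :=
  [/\ f u = 0, f v = 1 & forall x y, u <= x -> x <= y -> y <= v ->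
    c * (y - x) <= f y - f x <= C * (y - x)].

Record expanding_pair (R : realType) (a b C c : R) (f0 f1 : R -> R) : Prop := {
  ep_a : 0 < a;
  ep_ab : a <= b;
  ep_b : b < 1;
  ep_c : 1 < c;
  ep_C : 1 < C;
  ep_f0 : expanding C c 0 b f0;
  ep_f1 : expanding C c a 1 f1 }.

Section Cut.
Variables (R : realType) (f0 f1 : R -> R) (p : R).

(* [iter n cut w u v] is the sum of [w] over the images under [T_p ^n] of the
   intervals of continuity of [T_p ^n] in [(u, v)]. *)
Definition cut (w : R -> R -> R) (u v : R) : R :=
  if v <= p then w (f0 u) (f0 v)
  else if p <= u then w (f1 u) (f1 v)
  else w (f0 u) (f0 p) + w (f1 p) (f1 v).

Definition lap_number n : R -> R -> R := iter n cut (fun _ _ => 1).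
Definition lap_length n : R -> R -> R := iter n cut (fun u v => v - u).

Variant cut_spec (w : R -> R -> R) (u v : R) : R -> Type :=
| CutLeft of v <= p : cut_spec w u v (w (f0 u) (f0 v))
| CutRight of p <= u : cut_spec w u v (w (f1 u) (f1 v))
| CutMid of u < p & p < v : cut_spec w u v (w (f0 u) (f0 p) + w (f1 p) (f1 v)).

Lemma cutP w u v : cut_spec w u v (cut w u v).
Proof.
rewrite /cut; case: (leP v p) => [|pv]; first exact: CutLeft.
by case: (leP p u) => [|up]; [exact: CutRight|exact: CutMid].
Qed.

Lemma cut_left w u v : v <= p -> cut w u v = w (f0 u) (f0 v).
Proof. by rewrite /cut => ->. Qed.

Lemma cut_right w u v : u < v -> p <= u -> cut w u v = w (f1 u) (f1 v).
Proof. by move=> uv pu; rewrite /cut leNgt (le_lt_trans pu uv) /= pu. Qed.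

Lemma cut_mid w u v : u < p -> p < v ->
  cut w u v = w (f0 u) (f0 p) + w (f1 p) (f1 v).
Proof. by move=> up pv; rewrite /cut leNgt pv /= leNgt up. Qed.

Lemma iter_cutD (w w' : R -> R -> R) n u v :
  iter n cut (fun u v => w u v + w' u v) u v = iter n cut w u v + iter n cut w' u v.
Proof.
elim: n u v => [//|n IH] u v; rewrite !iterS /cut; case: ifP => // _; case: ifP => // _.
by rewrite !IH addrACA.
Qed.

Lemma iter_cutZ k (w : R -> R -> R) n u v :
  iter n cut (fun u v => k * w u v) u v = k * iter n cut w u v.
Proof.
elim: n u v => [//|n IH] u v; rewrite !iterS /cut; case: ifP => // _; case: ifP => // _.
by rewrite !IH mulrDr.
Qed.

Variables (a b C c : R).
Hypothesis hf : expanding_pair a b C c f0 f1.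
Hypothesis hp : a <= p <= b.

Let a0 := ep_a hf.
Let b1 := ep_b hf.
Let cM d : 0 <= d -> d <= c * d.
Proof. by move=> d0; rewrite -[leLHS]mul1r ler_wpM2r// ltW// (ep_c hf). Qed.

Lemma p_gt0 : 0 < p. Proof. by case/andP: hp => /(lt_le_trans a0). Qed.
Lemma p_lt1 : p < 1. Proof. by case/andP: hp => _ /le_lt_trans; apply. Qed.

Lemma f0_expand x y : 0 <= x -> x <= y -> y <= p ->
  c * (y - x) <= f0 y - f0 x <= C * (y - x).
Proof.
move=> x0 xy yp; case: (ep_f0 hf) => _ _; apply=> //.
by case/andP: hp => _; exact: le_trans.
Qed.

Lemma f1_expand x y : p <= x -> x <= y -> y <= 1 ->
  c * (y - x) <= f1 y - f1 x <= C * (y - x).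
Proof.
move=> px xy y1; case: (ep_f1 hf) => _ _; apply=> //.
by case/andP: hp => + _; move=> /le_trans; apply.
Qed.

Lemma f00 : f0 0 = 0. Proof. by case: (ep_f0 hf). Qed.
Lemma f11 : f1 1 = 1. Proof. by case: (ep_f1 hf). Qed.

Lemma f0_le x y : 0 <= x -> x <= y -> y <= p -> f0 x <= f0 y.
Proof. by move=> x0 xy yp; case/andP: (f0_expand x0 xy yp) => + _; have := @cM (y - x); lra. Qed.

Lemma f1_le x y : p <= x -> x <= y -> y <= 1 -> f1 x <= f1 y.
Proof. by move=> px xy y1; case/andP: (f1_expand px xy y1) => + _; have := @cM (y - x); lra. Qed.

Lemma f0_lt x y : 0 <= x -> x < y -> y <= p -> f0 x < f0 y.
Proof. by move=> x0 xy yp; case/andP: (f0_expand x0 (ltW xy) yp) => + _; have := @cM (y - x); lra. Qed.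

Lemma f1_lt x y : p <= x -> x < y -> y <= 1 -> f1 x < f1 y.
Proof. by move=> px xy y1; case/andP: (f1_expand px (ltW xy) y1) => + _; have := @cM (y - x); lra. Qed.

Lemma f0_01 x : 0 <= x -> x <= p -> 0 <= f0 x <= 1.
Proof.
move=> x0 xp; rewrite -{1}f00 f0_le//=.
case: (ep_f0 hf) => _ fb /(_ x b x0); rewrite fb; case/andP: hp => _ pb.
by move=> /(_ (le_trans xp pb) (lexx _))/andP[+ _]; have := @cM (b - x); lra.
Qed.

Lemma f1_01 x : p <= x -> x <= 1 -> 0 <= f1 x <= 1.
Proof.
move=> px x1; rewrite -{1}f11 f1_le// andbT.
case: (ep_f1 hf) => fa _ /(_ a x (lexx _)); rewrite fa; case/andP: hp => pa _.
by move=> /(_ (le_trans pa px) x1)/andP[+ _]; have := @cM (x - a); lra.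
Qed.

Definition sub01 u v := [&& 0 <= u, u < v & v <= (1 : R)].

Lemma sub01_left u v : sub01 u v -> v <= p -> sub01 (f0 u) (f0 v).
Proof.
move=> /and3P[u0 uv v1] vp; apply/and3P; split; last 1 first.
- by have /andP[] := f0_01 (le_trans u0 (ltW uv)) vp.
- by have /andP[] := f0_01 u0 (le_trans (ltW uv) vp).
- exact: f0_lt.
Qed.

Lemma sub01_right u v : sub01 u v -> p <= u -> sub01 (f1 u) (f1 v).
Proof.
move=> /and3P[u0 uv v1] vp; apply/and3P; split; last 1 first.
- by have /andP[] := f1_01 (le_trans vp (ltW uv)) v1.
- by have /andP[] := f1_01 vp (le_trans (ltW uv) v1).
- exact: f1_lt.
Qed.

Lemma sub01_midl u : 0 <= u -> u < p -> sub01 (f0 u) (f0 p).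
Proof. by move=> u0 up; apply: sub01_left => //; rewrite /sub01 u0 up (ltW p_lt1). Qed.

Lemma sub01_midr v : p < v -> v <= 1 -> sub01 (f1 p) (f1 v).
Proof. by move=> pv v1; apply: sub01_right => //; rewrite /sub01 pv v1 (ltW p_gt0). Qed.

Lemma cut_le (w w' : R -> R -> R) : (forall u v, sub01 u v -> w u v <= w' u v) ->
  forall u v, sub01 u v -> cut w u v <= cut w' u v.
Proof.
move=> ww u v uv; case/and3P: (uv) => u0 ult v1; case: (cutP w u v) => [vp|pu|up pv].
- by rewrite cut_left// ww// sub01_left.
- by rewrite cut_right// ww// sub01_right.
- by rewrite cut_mid// lerD// ww//; [exact: sub01_midl|exact: sub01_midr].
Qed.

Lemma iter_cut_le (w w' : R -> R -> R) : (forall u v, sub01 u v -> w u v <= w' u v) ->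
  forall n u v, sub01 u v -> iter n cut w u v <= iter n cut w' u v.
Proof. by move=> ww; elim=> [//|n IH] u v uv; rewrite !iterS; exact: cut_le. Qed.

Lemma lap_number_ge1 n u v : sub01 u v -> 1 <= lap_number n u v.
Proof.
elim: n u v => [//|n IH] u v uv; case/and3P: (uv) => u0 ult v1.
rewrite /lap_number iterS -/(lap_number n); case: cutP => [vp|pu|up pv].
- by rewrite IH// sub01_left.
- by rewrite IH// sub01_right.
- have := IH _ _ (sub01_midl u0 up); have := IH _ _ (sub01_midr pv v1); lra.
Qed.

Lemma lap_number_le_exp n u v : sub01 u v -> lap_number n u v <= 2 ^+ n.
Proof.
elim: n u v => [//|n IH] u v uv; case/and3P: (uv) => u0 ult v1.
have e0 : 0 <= 2 ^+ n :> R by rewrite exprn_ge0.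
rewrite /lap_number iterS -/(lap_number n) exprS; case: cutP => [vp|pu|up pv].
- have := IH _ _ (sub01_left uv vp); lra.
- have := IH _ _ (sub01_right uv pu); lra.
- have := IH _ _ (sub01_midl u0 up); have := IH _ _ (sub01_midr pv v1); lra.
Qed.

(** Images of nested intervals stay nested. When only the larger interval is cut, the piece that
    misses the smaller one is dropped, its lap number being nonnegative. *)
Lemma lap_number_incl n u v u' v' : sub01 u' v' -> u' <= u -> u < v -> v <= v' ->
  lap_number n u v <= lap_number n u' v'.
Proof.
elim: n u v u' v' => [//|n IH] u v u' v' uv' u'u ult vv'.
case/and3P: (uv') => u0 ult' v1.
have uv : sub01 u v by rewrite /sub01 ult (le_trans u0)//= (le_trans vv').
case/and3P: (uv) => u0' _ v1'.
have g u2 v2 : sub01 u2 v2 -> 0 <= lap_number n u2 v2.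
  by move=> /(lap_number_ge1 n); apply: le_trans.
rewrite /lap_number !iterS -/(lap_number n).
case: (cutP _ u' v') => [vp'|pu'|up' pv'].
- have vp := le_trans vv' vp'; rewrite cut_left//; apply: IH; first exact: sub01_left.
  + by rewrite f0_le// (le_trans (ltW ult)).
  + by rewrite f0_lt.
  + by rewrite f0_le// (le_trans _ (ltW ult)).
- have pu := le_trans pu' u'u; rewrite cut_right//; apply: IH; first exact: sub01_right.
  + by rewrite f1_le// (le_trans (ltW ult)).
  + by rewrite f1_lt.
  + by rewrite f1_le// (le_trans _ (ltW ult)).
- have sl := sub01_midl u0 up'; have sr := sub01_midr pv' v1.
  case: (cutP _ u v) => [vp|pu|up pv].
  + apply: ler_wpDr; first exact: g.
    apply: IH => //; [|by rewrite f0_lt|by rewrite f0_le// (le_trans u0' (ltW ult))].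
    by rewrite f0_le// (le_trans (ltW ult)).
  + apply: ler_wpDl; first exact: g.
    apply: IH => //; [by rewrite f1_le// (le_trans (ltW ult))|by rewrite f1_lt|].
    by rewrite f1_le// (le_trans pu (ltW ult)).
  + apply: lerD; apply: IH => //.
    * by rewrite f0_le// ltW.
    * by rewrite f0_lt.
    * by rewrite f1_lt.
    * by rewrite f1_le// ltW.
Qed.

Lemma sub01_01 : sub01 0 1. Proof. by rewrite /sub01 lexx ltr01 lexx. Qed.

(** Each lap of the [m]th iterate has its image in the unit interval, so by [lap_number_incl] it
    splits into at most [lap_number n 0 1] laps in [n] further steps. *)
Lemma lap_number_submul m n :
  lap_number (m + n) 0 1 <= lap_number m 0 1 * lap_number n 0 1.
Proof.
rewrite /lap_number iterD.
have H u v : sub01 u v -> iter n cut (fun _ _ => 1) u v <= lap_number n 0 1 * 1.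
  by move=> /and3P[u0 uv v1]; rewrite mulr1; apply: lap_number_incl => //; exact: sub01_01.
by apply: le_trans (iter_cut_le H m sub01_01) _; rewrite (iter_cutZ _ (fun _ _ => 1)) mulrC.
Qed.

Lemma lap_length_expand n u v : sub01 u v -> c ^+ n * (v - u) <= lap_length n u v.
Proof.
elim: n u v => [|n IH] u v uv; first by rewrite mul1r.
have cn : 0 <= c ^+ n by rewrite exprn_ge0// ltW// (lt_trans ltr01)// (ep_c hf).
case/and3P: (uv) => u0 ult v1.
rewrite /lap_length iterS -/(lap_length n) exprSr -mulrA; case: cutP => [vp|pu|up pv].
- apply: le_trans (IH _ _ (sub01_left uv vp)); rewrite ler_wpM2l//.
  by have /andP[] := f0_expand u0 (ltW ult) vp.
- apply: le_trans (IH _ _ (sub01_right uv pu)); rewrite ler_wpM2l//.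
  by have /andP[] := f1_expand pu (ltW ult) v1.
- apply: le_trans (lerD (IH _ _ (sub01_midl u0 up)) (IH _ _ (sub01_midr pv v1))).
  rewrite -mulrDr ler_wpM2l//.
  have /andP[+ _] := f0_expand u0 (ltW up) (lexx p).
  by have /andP[+ _] := f1_expand (lexx p) (ltW pv) v1; lra.
Qed.
Lemma lap_length_growth n : c ^+ n <= lap_length n 0 1.
Proof. by have := lap_length_expand n sub01_01; rewrite subr0 mulr1. Qed.

Lemma lap_lengthD m n : c ^+ n * lap_length m 0 1 <= lap_length (m + n) 0 1.
Proof.
by rewrite /lap_length iterD -iter_cutZ; apply: iter_cut_le sub01_01 => u v; exact: lap_length_expand.
Qed.

(* Short intervals ending at [x] are never cut at [x] itself, hence not at all. *)
Lemma lap_number_short_left n x : 0 < x <= 1 ->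
  exists2 e, 0 < e & forall u, 0 <= u -> u < x -> x - u <= e -> lap_number n u x <= 1.
Proof.
have C0 : 0 < C by rewrite (lt_trans ltr01) ?(ep_C hf).
elim: n x => [|n IH] x /andP[x0 x1]; first by exists 1.
have [xp|px] := leP x p.
  have [|e e0 He] := IH (f0 x).
    have /andP[_ ->] := f0_01 (ltW x0) xp; rewrite andbT -f00; exact: f0_lt.
  exists (e / C); first by rewrite divr_gt0.
  move=> u u0 ux; rewrite ler_pdivlMr// => xu.
  rewrite /lap_number iterS cut_left//; apply: He; [|exact: f0_lt|].
  - by have /andP[] := f0_01 u0 (le_trans (ltW ux) xp).
  - by have /andP[_ +] := f0_expand u0 (ltW ux) xp; lra.
have [|e e0 He] := IH (f1 x).
  have /andP[_ ->] := f1_01 (ltW px) x1; rewrite andbT.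
  have /andP[+ _] := f1_01 (lexx p) (ltW p_lt1); move/le_lt_trans; apply; exact: f1_lt.
(* The first bound keeps [u] on the right of [p], the second makes the image at most [e] long. *)
exists (Num.min (x - p) (e / C)); first by rewrite lt_min subr_gt0 px divr_gt0.
move=> u u0 ux; rewrite le_min ler_pdivlMr// => /andP[xup xu].
have pu : p <= u by lra.
rewrite /lap_number iterS cut_right//; apply: He; [|exact: f1_lt|].
- by have /andP[] := f1_01 pu (le_trans (ltW ux) x1).
- by have /andP[_ +] := f1_expand pu (ltW ux) x1; lra.
Qed.

Lemma lap_number_short_right n x : 0 <= x < 1 ->
  exists2 e, 0 < e & forall v, x < v -> v <= 1 -> v - x <= e -> lap_number n x v <= 1.
Proof.
have C0 : 0 < C by rewrite (lt_trans ltr01) ?(ep_C hf).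
elim: n x => [|n IH] x /andP[x0 x1]; first by exists 1.
have [px|xp] := leP p x.
  have [|e e0 He] := IH (f1 x).
    have /andP[-> _] := f1_01 px (ltW x1); rewrite -[ltRHS]f11; exact: f1_lt.
  exists (e / C); first by rewrite divr_gt0.
  move=> v xv v1; rewrite ler_pdivlMr// => vx.
  rewrite /lap_number iterS cut_right//; apply: He; [exact: f1_lt| |].
  - by have /andP[] := f1_01 (le_trans px (ltW xv)) v1.
  - by have /andP[_ +] := f1_expand px (ltW xv) v1; lra.
have [|e e0 He] := IH (f0 x).
  have /andP[-> _] := f0_01 x0 (ltW xp).
  by have /andP[_] := f0_01 (ltW p_gt0) (lexx p); apply: lt_le_trans; exact: f0_lt.
exists (Num.min (p - x) (e / C)); first by rewrite lt_min subr_gt0 xp divr_gt0.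
move=> v xv v1; rewrite le_min ler_pdivlMr// => /andP[vxp vx].
have vp : v <= p by lra.
rewrite /lap_number iterS cut_left//; apply: He; [exact: f0_lt| |].
- by have /andP[] := f0_01 (le_trans x0 (ltW xv)) vp.
- by have /andP[_ +] := f0_expand x0 (ltW xv) vp; lra.
Qed.

(** The first cut leaves one piece ending at [f0 p] and one starting at [f1 p]; if they are short,
    the one-sided lemmas exclude further cuts. *)
Lemma lap_number_short n :
  exists2 e, 0 < e & forall u v, sub01 u v -> v - u <= e -> lap_number n u v <= 2.
Proof.
have C0 : 0 < C by rewrite (lt_trans ltr01) ?(ep_C hf).
elim: n => [|n [e e0 He]]; first by exists 1 => // *; rewrite /lap_number /=; lra.
have /and3P[q1 q2 q3] := sub01_midl (lexx 0) p_gt0.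
have [|e1 e10 He1] := @lap_number_short_left n (f0 p).
  by rewrite q3 andbT (le_lt_trans q1).
have /and3P[r1 r2 r3] := sub01_midr p_lt1 (lexx 1).
have [|e2 e20 He2] := @lap_number_short_right n (f1 p).
  by rewrite r1 (lt_le_trans r2).
exists (Num.min e (Num.min e1 e2) / C); first by rewrite divr_gt0// !lt_min e0 e10 e20.
move=> u v uv; rewrite ler_pdivlMr// !le_min => /and3P[h1 h2 h3].
case/and3P: (uv) => u0 ult v1.
rewrite /lap_number iterS -/(lap_number n); case: cutP => [vp|pu|up pv].
- apply: He; first exact: sub01_left.
  by have /andP[_ +] := f0_expand u0 (ltW ult) vp; lra.
- apply: He; first exact: sub01_right.
  by have /andP[_ +] := f1_expand pu (ltW ult) v1; lra.
- have C1 : 0 <= C * (p - u) by rewrite mulr_ge0 ?ltW// subr_gt0.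
  have C2 : 0 <= C * (v - p) by rewrite mulr_ge0 ?ltW// subr_gt0.
  have -> : 2 = 1 + 1 :> R by ring.
  apply: lerD.
  + apply: He1; [by case/and3P: (sub01_midl u0 up)|exact: f0_lt|].
    by have /andP[_ +] := f0_expand u0 (ltW up) (lexx p); lra.
  + apply: He2; [exact: f1_lt|by case/and3P: (sub01_midr pv v1)|].
    by have /andP[_ +] := f1_expand (lexx p) (ltW pv) v1; lra.
Qed.

(* In [M] steps, laps of length at most [e] at most double while the total length
   at least triples. *)
Lemma lap_number_le_length :
  exists2 A, 0 < A & forall n, lap_number n 0 1 <= A * lap_length n 0 1.
Proof.
have c0 : 0 < c by rewrite (lt_trans ltr01) ?(ep_c hf).
have [M HM] : exists M, 3 <= c ^+ M.
  have [|M HM] := @exp_lt_eps R c^-1 3^-1 _ (ltac:(by [])).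
    by rewrite invr_ge0 ltW//= invf_lt1 ?(ep_c hf).
  by exists M; move: HM; rewrite exprVn ltf_pV2 ?posrE ?exprn_gt0//; exact: ltW.
have [e e0 He] := lap_number_short M.
have L1 n : 1 <= lap_length n 0 1.
  by apply: le_trans (lap_length_growth n); rewrite exprn_ege1// ltW// (ep_c hf).
(* A lap longer than [e] yields at most [2 ^+ M] pieces, which [B] times its length dominates. The
   induction closes because [B + 2 * A <= 3 * A]. *)
pose B := 2 ^+ M / e; have B0 : 0 <= B by rewrite divr_ge0 ?exprn_ge0// ltW.
pose A := 2 ^+ M + B.
have A0 : 0 < A by rewrite ltr_wpDr// exprn_gt0.
exists A => // n; elim/ltn_ind: n => n IH.
have [nM|Mn] := ltnP n M.
  apply: le_trans (lap_number_le_exp n sub01_01) _.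
  apply: (@le_trans _ _ (2 ^+ M)); first by rewrite ler_eXn2l ?ltr1n// ltnW.
  by apply: le_trans (_ : A <= _); [rewrite lerDl|rewrite ler_peMr// ltW].
rewrite -(subnK Mn); set m := (n - M)%N.
case: M HM He @B B0 @A A0 IH Mn @m => [|M]; first by rewrite expr0 => *; exfalso; lra.
move=> HM He B B0 A A0 IH Mn m.
have mn : (m < n)%N by rewrite /m ltn_subrL (leq_trans _ Mn).
apply: (@le_trans _ _ (B * lap_length m 0 1 + 2 * lap_number m 0 1)).
  rewrite {1}/lap_number iterD -/(lap_number M.+1).
  rewrite -!iter_cutZ -iter_cutD; apply: iter_cut_le sub01_01 => u v uv.
  have [uve|uve] := leP (v - u) e.
    have := He _ _ uv uve; have : 0 <= B * (v - u) by rewrite mulr_ge0// subr_ge0 ltW//; case/and3P: uv.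
    by lra.
  apply: le_trans (lap_number_le_exp _ uv) _; rewrite mulr1 -[leLHS]addr0 lerD//.
  by rewrite /B mulrAC ler_pdivlMr// ler_wpM2l ?exprn_ge0// ltW.
apply: le_trans (_ : A * (c ^+ M.+1 * lap_length m 0 1) <= _); last first.
  by rewrite ler_wpM2l ?lap_lengthD// ltW.
have := IH m mn; have l0 : 0 <= lap_length m 0 1 by apply: le_trans (L1 m).
have : A * (3 * lap_length m 0 1) <= A * (c ^+ M.+1 * lap_length m 0 1).
  by rewrite ler_wpM2l ?(ltW A0)// ler_wpM2r.
have : B * lap_length m 0 1 <= A * lap_length m 0 1 by rewrite ler_wpM2r// /A lerDr exprn_ge0.
lra.
Qed.

(** * Visits to the discontinuity and the kneading function *)

(** The strict comparison gives [p] the digit 0, in accordance with the lower map, which applies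
    [f0] there. *)
Definition digit (u : R) : R := (p < u)%R%:R.

(** Composition with the lower map, corrected on the right of [p] by a constant so that increments
    add up across [p]: the action of [cut] on increments becomes an action on functions. *)
Definition pull (G : R -> R) (u : R) : R :=
  if p < u then G (f1 u) + (G (f0 p) - G (f1 p)) else G (f0 u).

(* For [u <= v], [visits n v - visits n u] is the number of [x] with [u <= x < v]
   that the [n]th iterate of the upper Lorenz map sends to [p]. *)
Definition visits n : R -> R := iter n pull digit.

Definition nondecreasing01 (G : R -> R) :=
  forall u v, 0 <= u -> u <= v -> v <= 1 -> G u <= G v.

Lemma digit_01 u : 0 <= digit u <= 1.
Proof. by rewrite /digit; case: (p < u); rewrite lexx ler01. Qed.

Lemma digit_nd : nondecreasing01 digit.
Proof.
move=> u v _ uv _; rewrite /digit; case: (boolP (p < u)) => pu; case: (boolP (p < v)) => pv; rewrite ?lexx ?ler01//.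
by rewrite (lt_le_trans pu uv) in pv.
Qed.

Lemma cut_diff G u v : sub01 u v ->
  cut (fun u v => G v - G u) u v = pull G v - pull G u.
Proof.
move=> /and3P[u0 uv v1]; rewrite /pull; case: cutP => [vp|pu|up pv].
- by rewrite !ltNge vp (le_trans (ltW uv) vp).
- rewrite (le_lt_trans pu uv); move: pu; rewrite le_eqVlt => /predU1P[<-|->]; rewrite ?ltxx; ring.
- rewrite pv ltNge (ltW up) /=; ring.
Qed.

Lemma pull_nd G : nondecreasing01 G -> nondecreasing01 (pull G).
Proof.
move=> Gn u v u0; rewrite le_eqVlt => /predU1P[-> //|uv] v1.
have uv01 : sub01 u v by rewrite /sub01 u0 uv v1.
have Gs u' v' : sub01 u' v' -> 0 <= G v' - G u'.
  by move=> /and3P[? /ltW ? ?]; rewrite subr_ge0 Gn.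
rewrite -subr_ge0 -cut_diff//; case: cutP => [vp|pu|pu pv]; last apply: addr_ge0; apply: Gs.
- exact: sub01_left.
- exact: sub01_right.
- exact: sub01_midl.
- exact: sub01_midr.
Qed.

Lemma visits_nd n : nondecreasing01 (visits n).
Proof. by elim: n => [|n IH]; [exact: digit_nd|exact: pull_nd]. Qed.

Lemma visits0 n : visits n 0 = 0.
Proof.
elim: n => [|n IH]; first by rewrite /visits /= /digit ltNge ltW ?p_gt0.
by rewrite /visits iterS /pull ltNge (ltW p_gt0) /= f00.
Qed.

Lemma visits_ge0 n u : 0 <= u -> u <= 1 -> 0 <= visits n u.
Proof. by move=> u0 u1; rewrite -(visits0 n) visits_nd. Qed.

Lemma iter_cut_diff n G u v : sub01 u v ->
  iter n cut (fun u v => G v - G u) u v = iter n pull G v - iter n pull G u.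
Proof.
elim: n G u v => [//|n IH] G u v uv; rewrite !iterSr -IH//.
(* Equality is split into two inequalities because [cut_diff] holds only under [sub01], which is all
   that [iter_cut_le] asks for. *)
by apply/le_anti/andP; split; apply: iter_cut_le uv => u' v' uv'; rewrite cut_diff.
Qed.

Lemma visitsE n : visits n 1 = iter n cut (fun u v => digit v - digit u) 0 1.
Proof. by rewrite iter_cut_diff ?sub01_01// -/(visits n) visits0 subr0. Qed.

Lemma visits_le_laps n : visits n 1 <= lap_number n 0 1.
Proof.
rewrite visitsE.
by apply: iter_cut_le sub01_01 => u v _; have := digit_01 u; have := digit_01 v; lra.
Qed.

(** A lap splits in the next step only if its image has [p] inside, and then [digit] grows by 1
    across that image. *)
Lemma lap_number_succ n : lap_number n.+1 0 1 <= lap_number n 0 1 + visits n 1.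
Proof.
rewrite visitsE -iter_cutD /lap_number iterSr.
apply: iter_cut_le sub01_01 => u v uv.
have := digit_nd; case: cutP => [vp|pu|lup pv] nd.
- by rewrite lerDl subr_ge0 nd//; case/and3P: uv => // _ /ltW.
- by rewrite lerDl subr_ge0 nd//; case/and3P: uv => // _ /ltW.
- by rewrite /digit pv ltNge (ltW lup) subr0.
Qed.

Definition itinerary u k : R := digit (iter k (lower_lorenz f0 f1 p) u).
Definition psi t u : R := psum (itinerary u) t.
(* The Milnor-Thurston kneading function of the map. *)
Definition kneading t : R := 1 - t * (psi t (f0 p) - psi t (f1 p)).

Lemma itinerary_01 u k : 0 <= itinerary u k <= 1. Proof. exact: digit_01. Qed.

Lemma itinerary_le1 u k : `|itinerary u k| <= 1.
Proof. by have /andP[? ?] := itinerary_01 u k; rewrite ger0_norm. Qed.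

Lemma psi_rec t u : 0 <= t < 1 -> psi t u = digit u + t * psi t (lower_lorenz f0 f1 p u).
Proof.
move=> t01; rewrite /psi (psum_shift t01 (itinerary_le1 u)); congr (_ + _ * psum _ _).
by apply/funext => k; rewrite /itinerary iterSr.
Qed.

Lemma psi_bound t u : 0 <= t < 1 -> `|psi t u| <= 1 / (1 - t).
Proof. by move=> t01; apply: psum_bound t01 (itinerary_le1 u). Qed.

Lemma psi0 t : 0 <= t < 1 -> psi t 0 = 0.
Proof.
move=> t01; have /andP[t0 t1] := t01.
have := psi_rec 0 t01.
rewrite /lower_lorenz (ltW p_gt0) f00 /digit ltNge (ltW p_gt0) add0r => /eqP.
by rewrite -subr_eq0 -{1}[psi t 0]mul1r -mulrBl mulf_eq0 subr_eq0 gt_eqF// => /eqP.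
Qed.

Definition visit_sum t N u : R := \sum_(n < N) t ^+ n * visits n u.

Lemma visit_sum_rec t N u : visit_sum t N.+1 u = digit u + t * pull (visit_sum t N) u.
Proof.
rewrite /visit_sum big_ord_recl expr0 mul1r; congr (_ + _).
under eq_bigr do rewrite lift0 exprS -mulrA.
rewrite -mulr_sumr; congr (_ * _); rewrite /visits /pull.
under eq_bigr do rewrite iterS /pull.
case: ifP => pu //; rewrite -sumrB -big_split /=.
by apply: eq_bigr => i _; rewrite mulrDr mulrBr.
Qed.

Lemma visit_sum_nd t N : 0 <= t -> nondecreasing01 (visit_sum t N).
Proof.
move=> t0 u v u0 uv v1; apply: ler_sum => n _.
by rewrite ler_wpM2l ?exprn_ge0// visits_nd.
Qed.

Lemma image_le : f1 p <= f0 p.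
Proof.
have /andP[h0 _] := f0_expand (lexx 0) (ltW p_gt0) (lexx p).
have /andP[h1 _] := f1_expand (lexx p) (ltW p_lt1) (lexx 1).
by move: h0 h1; rewrite f00 f11; have := ep_c hf; lra.
Qed.

Lemma lower_lorenz01 u : 0 <= u <= 1 -> 0 <= lower_lorenz f0 f1 p u <= 1.
Proof.
move=> /andP[u0 u1]; rewrite /lower_lorenz; case: (leP u p) => [up|/ltW pu].
- exact: f0_01.
- exact: f1_01.
Qed.

(* The generating function of the numbers of visits is a multiple of [psi t],
   with factor the reciprocal of the kneading function. *)
Lemma kneading_of_visit_sum t M : 0 <= t < 1 -> (forall N, visit_sum t N 1 <= M) ->
  [/\ (1 + M)^-1 <= kneading t, 0 <= M,
      forall N, visit_sum t N 1 <= psi t 1 / kneading t & nondecreasing01 (psi t)].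
Proof.
move=> t01 SM; have /andP[t0 t1] := t01.
pose S u := limn (fun N => visit_sum t N u).
have mono u : 0 <= u <= 1 -> nondecreasing_seq (fun N => visit_sum t N u).
  move=> /andP[u0 u1]; apply/nondecreasing_seqP => N.
  by rewrite /visit_sum big_ord_recr /= lerDl mulr_ge0 ?exprn_ge0// visits_ge0.
have bnd u N : 0 <= u <= 1 -> visit_sum t N u <= M.
  by move=> /andP[u0 u1]; apply: le_trans (SM N); apply: visit_sum_nd.
have cv u : 0 <= u <= 1 -> cvgn (fun N => visit_sum t N u).
  move=> u01; apply: nondecreasing_is_cvgn; first exact: mono.
  by exists M => _ [N _ <-]; exact: bnd.
have le_S u N : 0 <= u <= 1 -> visit_sum t N u <= S u.
  by move=> u01; apply: nondecreasing_cvgn_le; [exact: mono|exact: cv].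
have S_le u : 0 <= u <= 1 -> S u <= M.
  by move=> u01; apply: limr_le; [exact: cv|near=> N; exact: bnd].
have S_ge0 u : 0 <= u <= 1 -> 0 <= S u.
  by move=> u01; apply: le_trans (le_S u 0%N u01); rewrite /visit_sum big_ord0.
have Snd : nondecreasing01 S.
  move=> u v u0 uv v1; apply: ler_lim.
  - by apply: cv; rewrite u0 (le_trans uv).
  - by apply: cv; rewrite v1 (le_trans u0).
  - by near=> N; exact: visit_sum_nd.
have be01 : 0 <= f0 p <= 1 by apply: f0_01 => //; rewrite ltW// p_gt0.
have al01 : 0 <= f1 p <= 1 by apply: f1_01 => //; rewrite ltW// p_lt1.
(* The constant in [pull] is the same for all points on the right of [p], so it merges with the
   digit into the factor [X], and [psum_unique] gives [S u = X * psi t u]. *)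
pose X := 1 + t * (S (f0 p) - S (f1 p)).
have Y0 : 0 <= S (f0 p) - S (f1 p).
  by rewrite subr_ge0; apply: Snd image_le _; [case/andP: al01|case/andP: be01].
have X1 : 1 <= X by rewrite lerDl mulr_ge0.
have Srec u : 0 <= u <= 1 -> S u = digit u * X + t * S (lower_lorenz f0 f1 p u).
  move=> u01; have Tu01 := lower_lorenz01 u01.
  have -> : digit u * X + t * S (lower_lorenz f0 f1 p u) = digit u + t * pull S u.
    rewrite /digit /X /pull /lower_lorenz; case: (ltP p u) => _ /=; rewrite ?mulr1n ?mulr0n; ring.
  apply/cvg_lim => //; rewrite -(cvg_shiftS _).
  under eq_fun do rewrite visit_sum_rec.
  apply: cvgD; first exact: cvg_cst.
  apply: cvgMr; move: Tu01; rewrite /pull /lower_lorenz; case: (ltP p u) => _ Tu01; last exact: cv.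
  by apply: cvgD; [exact: cv|apply: cvgB; exact: cv].
have M0 : 0 <= M by apply: le_trans (S_ge0 1 _) (S_le 1 _); rewrite lexx ler01.
have S_psi u : 0 <= u <= 1 -> S u = X * psi t u.
  move=> u01; have it01 k : 0 <= iter k (lower_lorenz f0 f1 p) u <= 1.
    by elim: k => //= k IH; exact: lower_lorenz01.
  rewrite -[LHS](@mulVKf _ X) ?gt_eqF ?(lt_le_trans ltr01)//; congr (_ * _).
  apply: (@psum_unique _ _ (fun k => X^-1 * S (iter k (lower_lorenz f0 f1 p) u)) _ 1 M t01).
  - exact: itinerary_le1.
  - move=> k; have Sk := S_ge0 _ (it01 k).
    have Xi0 : 0 <= X^-1 by rewrite invr_ge0 (le_trans ler01).
    rewrite ger0_norm; last exact: mulr_ge0.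
    apply: le_trans (S_le _ (it01 k)); rewrite ler_piMl//.
    by rewrite invf_le1// (lt_le_trans ltr01).
  - move=> k; rewrite (Srec _ (it01 k)) -iterS /itinerary.
    by field; rewrite gt_eqF// (lt_le_trans ltr01).
have X0 : 0 < X by rewrite (lt_le_trans ltr01).
(* Substituting [S u = X * psi t u] into the definition of [X] gives [1 = X * kneading t]. *)
have XK : kneading t = X^-1.
  have psiE u : 0 <= u <= 1 -> psi t u = S u / X.
    by move=> u01; rewrite (S_psi u u01) mulrAC mulfV ?mul1r// gt_eqF.
  rewrite /kneading (psiE _ be01) (psiE _ al01).
  have -> : t * (S (f0 p) / X - S (f1 p) / X) = (X - 1) / X by rewrite /X; field; exact: lt0r_neq0.
  by field; exact: lt0r_neq0.
split => //.
- rewrite XK lef_pV2 ?posrE//; last by rewrite ltr_pwDl.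
  rewrite lerD2l; apply: le_trans (S_le _ be01).
  have := S_ge0 _ al01; have : t * (S (f0 p) - S (f1 p)) <= S (f0 p) - S (f1 p).
    by rewrite ler_piMl// ltW.
  lra.
- by move=> N; rewrite XK invrK mulrC -S_psi ?ler01 ?lexx// le_S// ler01 lexx.
- move=> u v u0 uv v1; have u1 := le_trans uv v1; have v0 := le_trans u0 uv.
  by rewrite -(ler_pM2l X0) -!S_psi ?u0 ?v0//; exact: Snd.
Unshelve. all: by end_near. Qed.

(** The defect [G N] of the partial sum satisfies [G N.+1 = t * pull (G N)]. It is nondecreasing for
    [N = 0] by hypothesis and stays so by [pull_nd]; as it vanishes at 0, it is nonnegative at 1. *)
Lemma visit_sum_of_kneading t : 0 <= t < 1 -> 0 < kneading t -> nondecreasing01 (psi t) ->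
  forall N, visit_sum t N 1 <= psi t 1 / kneading t.
Proof.
move=> t01 K0 nd; have /andP[t0 t1] := t01.
pose G N u := psi t u / kneading t - visit_sum t N u.
have Grec N u : G N.+1 u = t * pull (G N) u.
  rewrite /G visit_sum_rec {1}(psi_rec u t01) /pull /lower_lorenz /digit.
  have K1 : (kneading t)^-1 = 1 + t * (psi t (f0 p) - psi t (f1 p)) / kneading t.
    apply: (mulIf (lt0r_neq0 K0)); rewrite mulVf ?gt_eqF// mulrDl divfK ?gt_eqF// mul1r.
    by rewrite /kneading subrK.
  case: (ltP p u) => pu; rewrite ?mulr1n ?mulr0n; last by field; rewrite gt_eqF.
  by rewrite mulrDl mul1r {1}K1; field; rewrite gt_eqF.
have Gnd N : nondecreasing01 (G N).
  elim: N => [|N IH] u v u0 uv v1.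
    by rewrite /G /visit_sum !big_ord0 !subr0 ler_pM2r ?invr_gt0// nd.
  by rewrite !Grec ler_wpM2l// pull_nd.
move=> N; have := Gnd N 0 1 (lexx _) ler01 (lexx _).
rewrite {1}/G psi0// mul0r sub0r /visit_sum.
by under eq_bigr do rewrite visits0 mulr0; rewrite big1_eq oppr0 subr_ge0.
Qed.

(** * Entropy and convergence of the visit sums *)

Definition entropy : R := growth (fun n => ln (lap_number n 0 1)).

Let lap_gt0 n : 0 < lap_number n 0 1.
Proof. exact: lt_le_trans ltr01 (lap_number_ge1 n sub01_01). Qed.

Lemma ln_lap_number_ge0 n : 0 <= ln (lap_number n 0 1).
Proof. by rewrite ln_ge0// lap_number_ge1// sub01_01. Qed.

Lemma ln_lap_numberD m n :
  ln (lap_number (m + n) 0 1) <= ln (lap_number m 0 1) + ln (lap_number n 0 1).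
Proof. by rewrite -lnM ?posrE// ler_ln ?posrE ?mulr_gt0//; exact: lap_number_submul. Qed.

Lemma lap_number_ge_entropy n : expR entropy ^+ n <= lap_number n 0 1.
Proof.
rewrite -expRM_natl -[leRHS]lnK ?posrE// ler_expR.
exact: growth_le ln_lap_number_ge0 n.
Qed.

Lemma lap_number_ge_length n : lap_length n 0 1 <= lap_number n 0 1.
Proof. by apply: iter_cut_le sub01_01 => u v /and3P[]; lra. Qed.

(** Images of laps have length at most 1, so there are at least [c ^+ n] laps and the entropy is at
    least [ln c]. *)
Lemma entropy_gt0 : 0 < entropy.
Proof.
apply: (@lt_le_trans _ _ (ln c)); first by rewrite ln_gt0// (ep_c hf).
have c0 : 0 < c by rewrite (lt_trans ltr01) ?(ep_c hf).
apply: growth_ge ln_lap_number_ge0 _ _ => n.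
rewrite mulr_natl -lnXn// ler_ln ?posrE ?exprn_gt0//.
exact: le_trans (lap_length_growth n) (lap_number_ge_length n).
Qed.

Lemma visit_sum_bounded t : 0 < t -> t * expR entropy < 1 ->
  exists M, forall N, visit_sum t N 1 <= M.
Proof.
move=> t0 tH; set h := t * expR entropy in tH *.
have h0 : 0 < h by rewrite mulr_gt0 ?expR_gt0.
(* With [q] strictly between [h] and 1, [ln (q / h)] is the excess over the entropy that
   [growth_upper] needs, and the terms stay below a geometric series of ratio [q]. *)
pose q := (h + 1) / 2; have hq : h < q by rewrite /q; lra.
have q1 : q < 1 by rewrite /q; lra.
have q0 : 0 < q := lt_trans h0 hq.
have hs : entropy < entropy + ln (q / h) by rewrite ltrDl ln_gt0// ltr_pdivlMr// mul1r.
have [B HB] := growth_upper ln_lap_number_ge0 ln_lap_numberD hs.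
have e0 := expR_gt0 B.
exists (expR B * (1 - q)^-1) => N.
apply: (@le_trans _ _ (\sum_(n < N) expR B * q ^+ n)); last first.
  by rewrite -mulr_sumr ler_wpM2l ?(ltW e0)// geometric_sum_le// q1 ltW.
apply: ler_sum => n _.
have : lap_number n 0 1 <= expR B * (q / t) ^+ n.
  rewrite -[leLHS]lnK ?posrE//; apply: (@le_trans _ _ (expR (n%:R * (entropy + ln (q / h)) + B))).
    by rewrite ler_expR.
  have qh : q / h \is Num.pos by rewrite posrE; exact: divr_gt0.
  rewrite expRD mulrC expRM_natl expRD lnK//.
  have -> // : expR entropy * (q / h) = q / t.
  by rewrite /h; field; rewrite !gt_eqF ?expR_gt0.
move=> Hn; apply: (@le_trans _ _ (t ^+ n * (expR B * (q / t) ^+ n))).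
  by rewrite ler_wpM2l ?exprn_ge0 ?(ltW t0)// (le_trans (visits_le_laps n)).
by rewrite mulrCA -exprMn mulrCA mulfV ?gt_eqF// mulr1.
Qed.

(** If [t * expR entropy] were at least 1, so would be every term of the generating function [L] of
    the lap numbers; but [lap_number_succ] bounds [(1 - t) * L N] by [1 + M]. *)
Lemma visit_sum_unbounded t M : 0 < t < 1 -> (forall N, visit_sum t N 1 <= M) ->
  t * expR entropy < 1.
Proof.
move=> /andP[t0 t1] SM; rewrite ltNge; apply/negP => h1.
pose L N := \sum_(n < N) t ^+ n * lap_number n 0 1.
have LN N : N%:R <= L N.
  rewrite -[N%:R]mulr_natl mulr1 -[X in X%:R]card_ord -sum1_card natr_sum.
  apply: ler_sum => n _; apply: (@le_trans _ _ (t ^+ n * expR entropy ^+ n)).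
    by rewrite -exprMn exprn_ege1.
  by rewrite ler_wpM2l ?exprn_ge0 ?(ltW t0)// lap_number_ge_entropy.
have Lrec N : L N.+1 <= 1 + t * L N + t * visit_sum t N 1.
  rewrite /L big_ord_recl expr0 mul1r -addrA; apply: lerD; first exact: lexx.
  rewrite !mulr_sumr -big_split; apply: ler_sum => n _.
  rewrite lift0 /= exprS -!mulrA -!mulrDr ler_pM2l//.
  by rewrite ler_pM2l ?exprn_gt0// lap_number_succ.
have Linc N : L N <= L N.+1.
  by rewrite /L big_ord_recr /= lerDl mulr_ge0 ?exprn_ge0 ?ltW.
have LM N : (1 - t) * L N <= 1 + M.
  have : t * visit_sum t N 1 <= M.
    apply: le_trans (SM N); rewrite ler_piMl ?(ltW t1)//.
    by apply: sumr_ge0 => n _; rewrite mulr_ge0 ?exprn_ge0 ?(ltW t0)// visits_ge0.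
  by have := Lrec N; have := Linc N; lra.
have t1' : 0 < 1 - t by rewrite subr_gt0.
have HN := archi_boundP (normr_ge0 ((1 + M) / (1 - t))); set N := Num.bound _ in HN.
have {}HN := le_lt_trans (ler_norm _) HN.
move: HN; rewrite ltr_pdivrMr// mulrC => HN.
have := LM N; have : (1 - t) * N%:R <= (1 - t) * L N by rewrite ler_wpM2l ?(ltW t1').
lra.
Qed.

End Cut.

(** * Perturbation of the discontinuity *)

Section Perturbation.
Variables (R : realType) (a b C c : R) (f0 f1 : R -> R).
Hypothesis hf : expanding_pair a b C c f0 f1.

Let cM d : 0 <= d -> d <= c * d.
Proof. by move=> d0; rewrite -[leLHS]mul1r ler_wpM2r// ltW// (ep_c hf). Qed.

Let C0 : 0 < C. Proof. by rewrite (lt_trans ltr01) ?(ep_C hf). Qed.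

(* As the maps expand distances, [x] stays on the left of the orbit of [u] by at
   least [p0 - p], so that [x] falls on the left of [p] when [u] falls on [p0]. *)
Lemma itinerary_left N p0 u : a <= p0 <= b -> 0 <= u <= 1 ->
  exists2 d, 0 < d & forall p x, a <= p -> p < p0 -> 0 <= x -> x <= u ->
    p0 - p <= u - x -> u - x < d ->
    forall k, (k < N)%N -> itinerary f0 f1 p x k = itinerary f0 f1 p0 u k.
Proof.
move=> hp0; elim: N u => [|N IH] u /andP[u0 u1]; first by exists 1.
have [ulep|pu] := leP u p0.
  have [d d0 Hd] := IH _ (f0_01 hf hp0 u0 ulep).
  exists (d / C); first by rewrite divr_gt0.
  move=> p x ap pp x0 xu pxu; rewrite ltr_pdivlMr// => xud k.
  have xp : x <= p by lra.
  case: k => [|k] kN; first by rewrite /itinerary /= /digit ltNge xp ltNge ulep.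
  rewrite /itinerary !iterSr /lower_lorenz xp ulep.
  have /andP[e1 e2] := f0_expand hf hp0 x0 xu ulep.
  have ux0 : 0 <= u - x by lra.
  have := cM ux0 => e3.
  apply: Hd => //; [|lra|lra|lra].
  by have /andP[] := f0_01 hf hp0 x0 (le_trans xu ulep).
have [d d0 Hd] := IH _ (f1_01 hf hp0 (ltW pu) u1).
exists (Num.min (u - p0) (d / C)); first by rewrite lt_min subr_gt0 pu divr_gt0.
move=> p x ap pp x0 xu pxu; rewrite lt_min ltr_pdivlMr// => /andP[xp0 xud] k.
have px0 : p0 < x by lra.
have px : p < x := lt_trans pp px0.
case: k => [|k] kN; first by rewrite /itinerary /= /digit px pu.
rewrite /itinerary !iterSr /lower_lorenz !leNgt px pu /=.
have /andP[e1 e2] := f1_expand hf hp0 (ltW px0) xu u1.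
have ux0 : 0 <= u - x by lra.
have := cM ux0 => e3.
apply: Hd => //; [|lra|lra|lra].
by have /andP[] := f1_01 hf hp0 (ltW px0) (le_trans xu u1).
Qed.

Lemma psi_left N p0 u : a <= p0 <= b -> 0 <= u <= 1 ->
  exists2 d, 0 < d & forall p x, a <= p -> p < p0 -> 0 <= x -> x <= u ->
    p0 - p <= u - x -> u - x < d ->
    forall t, 0 <= t < 1 -> `|psi f0 f1 p t x - psi f0 f1 p0 t u| <= t ^+ N / (1 - t).
Proof.
move=> hp0 u01; have [d d0 Hd] := itinerary_left N hp0 u01.
exists d => // p x ap pp x0 xu pxu xud t t01.
by apply: psum_tail => // [k|k|]; [exact: itinerary_01|exact: itinerary_01|exact: Hd].
Qed.

(** When the discontinuity moves left from [p0] to [p], each of its two images moves left by at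
    least [p0 - p] and at most [C * (p0 - p)], as [psi_left] requires. Each image contributes one
    error term. *)
Lemma kneading_left N p0 : a <= p0 <= b ->
  exists2 d, 0 < d & forall p, a <= p -> p < p0 -> p0 - p < d ->
    forall t, 0 <= t < 1 ->
    `|kneading f0 f1 p t - kneading f0 f1 p0 t| <= 2 * (t ^+ N / (1 - t)).
Proof.
move=> hp0; have a0 := ep_a hf; have b1 := ep_b hf; have /andP[ap0 p0b] := hp0.
have p00 : 0 <= p0 by lra.
have p01 : p0 <= 1 by lra.
have [d0 d00 H0] := psi_left N hp0 (f0_01 hf hp0 p00 (lexx _)).
have [d1 d10 H1] := psi_left N hp0 (f1_01 hf hp0 (lexx _) p01).
exists (Num.min d0 d1 / C); first by rewrite divr_gt0// lt_min d00.
move=> p ap pp; rewrite ltr_pdivlMr// lt_min => /andP[pd0 pd1] t t01.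
have hp : a <= p <= b by rewrite ap /=; lra.
have /andP[e1 e2] := f0_expand hf hp0 (ltac:(lra) : 0 <= p) (ltW pp) (lexx _).
have [_ _ /(_ p p0 ap (ltW pp) p01)/andP[e3 e4]] := ep_f1 hf.
have e5 := cM (ltac:(lra) : 0 <= p0 - p).
have /andP[g0 _] := f0_01 hf hp (ltac:(lra) : 0 <= p) (lexx _).
have /andP[g1 _] := f1_01 hf hp (lexx _) (ltac:(lra) : p <= 1).
have K0 := H0 p (f0 p) ap pp g0 (ltac:(lra)) (ltac:(lra)) (ltac:(lra)) t t01.
have K1 := H1 p (f1 p) ap pp g1 (ltac:(lra)) (ltac:(lra)) (ltac:(lra)) t t01.
rewrite /kneading; set x := psi _ _ _ _ _ in K0 *; set y := psi _ _ p0 _ _ in K0 *.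
set z := psi _ _ _ _ _ in K1 *; set w := psi _ _ p0 _ _ in K1 *.
have -> : 1 - t * (x - z) - (1 - t * (y - w)) = t * (- (x - y) + (z - w)) by ring.
have /andP[t0 t1] := t01.
rewrite normrM (ger0_norm t0); apply: le_trans (_ : `|- (x - y) + (z - w)| <= _).
  by rewrite ler_piMl// ltW.
by apply: le_trans (ler_normD _ _) _; rewrite normrN; lra.
Qed.

(* If the entropy of [p] is too large, then the visit sums of [p] are bounded by
   [M1] up to the radius of convergence [r], hence also at [r]. *)
Lemma entropy_left_usc p0 s : a <= p0 <= b -> entropy f0 f1 p0 < s ->
  exists2 d, 0 < d & forall p, a <= p -> p < p0 -> p0 - p < d -> entropy f0 f1 p < s.
Proof.
move=> hp0 hs; have s0 : 0 < s by apply: lt_trans hs; exact: entropy_gt0 hf hp0.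
pose t := expR (- s); have t0 : 0 < t by exact: expR_gt0.
have t1 : t < 1 by rewrite /t expR_lt1 oppr_lt0.
have [|M HM] := visit_sum_bounded hf hp0 t0.
  by rewrite /t -expRD -[ltRHS]expR0 ltr_expR; lra.
have M0 : 0 <= M by have := HM 0%N; rewrite /visit_sum big_ord0.
pose m := (1 + M)^-1; have m0 : 0 < m by rewrite invr_gt0 ltr_wpDr.
have t1' : 0 < 1 - t by rewrite subr_gt0.
have t01 : 0 <= t < 1 by rewrite (ltW t0).
(* The bound is uniform in [r] because the visit sums at [r] are at most those at [t]. *)
have Km r : 0 <= r -> r <= t -> m <= kneading f0 f1 p0 r.
  move=> r0 rt.
  have [||//] := @kneading_of_visit_sum _ _ _ _ _ _ _ _ hf hp0 r M.
    by rewrite r0 (le_lt_trans rt).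
  move=> N; apply: le_trans (HM N); apply: ler_sum => n _.
  apply: ler_wpM2r; first exact: (visits_ge0 hf hp0).
  by rewrite lerXn2r ?nnegrE// ltW.
(* With this [N] the error in [kneading_left] is at most [m / 2] at all arguments up to [t]. *)
have [N HN] := exp_lt_eps t01 (ltac:(by rewrite !mulr_gt0// ) : 0 < m / 4 * (1 - t)).
have [d d0 Hd] := kneading_left N hp0.
exists d => // p ap pp ppd; have hp : a <= p <= b by rewrite ap ltW// (lt_le_trans pp)//; case/andP: hp0.
rewrite ltNge; apply/negP => sp.
pose r := expR (- entropy f0 f1 p); have r0 : 0 < r by exact: expR_gt0.
have rt : r <= t by rewrite ler_expR lerN2.
have r1 : r < 1 := le_lt_trans rt t1.
have KN q : 0 <= q -> q <= t -> m / 2 <= kneading f0 f1 p q.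
  move=> q0 qt; have := Km q q0 qt; have q1 := le_lt_trans qt t1.
  have := Hd p ap pp ppd q; rewrite q0 q1 => /(_ isT); rewrite ler_norml => /andP[+ _].
  have : q ^+ N / (1 - q) <= m / 4.
    rewrite ler_pdivrMr ?subr_gt0//; apply: le_trans (_ : t ^+ N <= _).
      by rewrite lerXn2r ?nnegrE// ltW.
    apply: le_trans (ltW HN) _; rewrite ler_wpM2l ?divr_ge0 ?(ltW m0)//; lra.
  lra.
pose M1 := (1 - t)^-1 / (m / 2).
have SM1 q N' : 0 < q -> q < r -> visit_sum f0 f1 p q N' 1 <= M1.
  move=> q0 qr; have qt : q <= t := ltW (lt_le_trans qr rt).
  have q1 := le_lt_trans qt t1; have q01 : 0 <= q < 1 by rewrite ltW.
  have [M' HM'] : exists M, forall N, visit_sum f0 f1 p q N 1 <= M.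
    apply: (visit_sum_bounded hf hp q0).
    by rewrite -ltr_pdivlMr ?expR_gt0// mul1r -expRN.
  have [_ _ H _] := kneading_of_visit_sum hf hp q01 HM'.
  apply: le_trans (H N') _; have Kq := KN q (ltW q0) qt.
  have K0 : 0 < kneading f0 f1 p q by apply: lt_le_trans Kq; rewrite divr_gt0.
  have psi1 : psi f0 f1 p q 1 <= (1 - t)^-1.
    apply: le_trans (ler_norm _) _; apply: le_trans (psi_bound _ _ _ _ q01) _.
    by rewrite mul1r lef_pV2 ?posrE ?subr_gt0// lerD2l lerN2.
  apply: (@le_trans _ _ ((1 - t)^-1 / kneading f0 f1 p q)).
    by rewrite ler_wpM2r// invr_ge0 ltW.
  by rewrite ler_wpM2l ?invr_ge0 ?(ltW t1')// lef_pV2 ?posrE// divr_gt0.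
have SR N' : visit_sum f0 f1 p r N' 1 <= 2 * M1.
  (* For fixed [N'], the point [q] is so close to [r] that, by Bernoulli's inequality, no term of
     the sum loses more than a factor 2. *)
  pose e := (2 * N'.+1%:R)^-1 : R.
  have e0 : 0 < e by rewrite invr_gt0 mulr_gt0.
  have e1 : e <= 2^-1.
    by rewrite /e invfM ler_piMr// invf_le1 ?ler1n// ltr0n.
  pose q := r * (1 - e).
  have e1' : 0 < 1 - e by lra.
  have q0 : 0 < q by rewrite mulr_gt0.
  have qr : q < r by rewrite /q gtr_pMr// gtrBl.
  have bern n : 1 - n%:R * e <= (1 - e) ^+ n.
    elim: n => [|n IHn]; first by rewrite mul0r subr0 expr0.
    rewrite exprS; apply: le_trans (_ : (1 - e) * (1 - n%:R * e) <= _).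
      rewrite -natr1; have : 0 <= n%:R * e * e by rewrite !mulr_ge0// ltW.
      lra.
    by rewrite ler_wpM2l// ltW.
  have hN : 2^-1 <= (1 - e) ^+ N'.
    apply: le_trans (bern N'); have : N'%:R * e <= 2^-1.
      rewrite /e invfM mulrCA ler_piMr// ler_pdivrMr ?ltr0n// mul1r ler_nat.
      exact: leqnSn.
    lra.
  have := SM1 q N' q0 qr; suff : 2^-1 * visit_sum f0 f1 p r N' 1 <= visit_sum f0 f1 p q N' 1 by lra.
  rewrite /visit_sum mulr_sumr; apply: ler_sum => n _; rewrite mulrA.
  apply: ler_wpM2r; first exact: (visits_ge0 hf hp).
  rewrite /q exprMn mulrC ler_wpM2l ?exprn_ge0 ?(ltW r0)//; apply: le_trans hN _.
  by rewrite ler_wiXn2l ?(ltW e1')// ?gerBl ?(ltW e0)// ltnW.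
have := visit_sum_unbounded hf hp (ltac:(by rewrite r0 r1) : 0 < r < 1) SR.
by rewrite /r -expRD addNr expR0 ltxx.
Qed.

(** The factor [t] in [kneading] shifts the digits by one place, which leaves 1 as constant
    coefficient; hence the function cannot vanish on an interval. *)
Lemma kneading_psum p t : 0 <= t < 1 ->
  let k j := if j is j.+1 then itinerary f0 f1 p (f1 p) j - itinerary f0 f1 p (f0 p) j else 1 in
  (forall j, `|k j| <= 1) /\ kneading f0 f1 p t = psum k t.
Proof.
move=> t01 k; have k1 j : `|k j| <= 1.
  case: j => [|j] /=; first by rewrite normr1.
  have := itinerary_01 f0 f1 p (f1 p) j; have := itinerary_01 f0 f1 p (f0 p) j.
  by rewrite ler_norml; lra.
split=> //; rewrite (psum_shift t01 k1) /k /=.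
rewrite (psumB t01 (itinerary_le1 f0 f1 p (f1 p)) (itinerary_le1 f0 f1 p (f0 p))).
by rewrite /kneading -/(psi _ _ _ _ _) -/(psi _ _ _ _ _); ring.
Qed.

(** If entropies at most [s] occurred arbitrarily close to [p0] on the left, the kneading function
    of [p0] would vanish between [r] and [t1], contrary to its constant coefficient 1. *)
Lemma entropy_left_lsc p0 s : a <= p0 <= b -> s < entropy f0 f1 p0 ->
  exists2 d, 0 < d & forall p, a <= p -> p < p0 -> p0 - p < d -> s < entropy f0 f1 p.
Proof.
move=> hp0 hs; have /andP[ap0 p0b] := hp0.
apply: contrapT => Hd.
have near_p d : 0 < d -> exists p, [/\ a <= p, p < p0, p0 - p < d & entropy f0 f1 p <= s].
  move=> d0; apply: contrapT => Hp; apply: Hd; exists d => // p ap pp ppd.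
  by rewrite ltNge; apply/negP => ps; apply: Hp; exists p.
(* As [s] may be negative, [t1] may exceed 1, whence the separate bound [t < 1] below. *)
pose r := expR (- entropy f0 f1 p0); pose t1 := expR (- s).
have r0 : 0 < r by exact: expR_gt0.
have r1 : r < 1 by rewrite expR_lt1 oppr_lt0 (entropy_gt0 hf hp0).
have rt1 : r < t1 by rewrite ltr_expR ltrN2.
have K0 t : 0 <= t < 1 -> r < t < t1 -> kneading f0 f1 p0 t = 0.
  move=> t01 /andP[rt tt1]; have t0 : 0 < t := lt_trans r0 rt.
  have /andP[_ tlt1] := t01.
  have t1' : 0 < 1 - t by rewrite subr_gt0.
  have sub p : a <= p <= b -> entropy f0 f1 p <= s ->
      0 < kneading f0 f1 p t /\ nondecreasing01 (psi f0 f1 p t).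
    move=> hp ps; have [|M HM] := visit_sum_bounded hf hp t0.
      rewrite -ltr_pdivlMr ?expR_gt0// mul1r -expRN.
      by apply: lt_le_trans tt1 _; rewrite ler_expR lerN2.
    have [K M0 _ nd] := kneading_of_visit_sum hf hp t01 HM; split=> //.
    by apply: lt_le_trans K; rewrite invr_gt0 ltr_wpDr.
  have Kge : 0 <= kneading f0 f1 p0 t.
    apply/ler_addgt0Pl => e e0.
    have [N HN] := exp_lt_eps t01 (ltac:(by rewrite mulr_gt0// divr_gt0) : 0 < e / 2 * (1 - t)).
    have [d d0 Hp] := kneading_left N hp0.
    have [p [ap pp ppd ps]] := near_p d d0.
    have := Hp p ap pp ppd t t01.
    have [Kp _] := sub p (ltac:(rewrite ap; lra)) ps.
    by move: HN; rewrite -ltr_pdivrMr// ler_norml; lra.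
  (* Monotonicity for [p] is applied to [u] and [v] both moved left by [p0 - p], which suits
     [psi_left]. There is no room for this at [u = 0], but there [psi] is 0 and elsewhere it is
     nonnegative. *)
  have nd : nondecreasing01 (psi f0 f1 p0 t).
    have psi_ge0 v : 0 <= psi f0 f1 p0 t v.
      apply: limr_ge; first exact: is_cvg_psum t01 (itinerary_le1 _ _ _ _).
      near=> n; rewrite /series /=; apply: sumr_ge0 => i _.
      by rewrite mulr_ge0 ?exprn_ge0 ?(ltW t0)//; case/andP: (itinerary_01 f0 f1 p0 v i).
    move=> u v; rewrite le_eqVlt => /predU1P[<- _ _|u0 uv v1]; first by rewrite (psi0 hf hp0).
    apply/ler_addgt0Pl => e e0.
    have [N HN] := exp_lt_eps t01 (ltac:(by rewrite mulr_gt0// divr_gt0) : 0 < e / 2 * (1 - t)).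
    have u01 : 0 <= u <= 1 by rewrite ltW// (le_trans uv).
    have v01 : 0 <= v <= 1 by rewrite v1 andbT ltW// (lt_le_trans u0).
    have [d d0 H0] := psi_left N hp0 u01.
    have [d' d0' H1] := psi_left N hp0 v01.
    have [|p [ap pp ppd ps]] := near_p (Num.min u (Num.min d d')).
      by rewrite !lt_min u0 d0.
    move: ppd; rewrite !lt_min => /and3P[pu pd pd'].
    have [_ nd] := sub p (ltac:(rewrite ap; lra)) ps.
    have := H0 p (u - (p0 - p)) ap pp (ltac:(lra)) (ltac:(lra)) (ltac:(lra)) (ltac:(lra)) t t01.
    have := H1 p (v - (p0 - p)) ap pp (ltac:(lra)) (ltac:(lra)) (ltac:(lra)) (ltac:(lra)) t t01.
    have := nd (u - (p0 - p)) (v - (p0 - p)) (ltac:(lra)) (ltac:(lra)) (ltac:(lra)).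
    by move: HN; rewrite -ltr_pdivrMr// !ler_norml; lra.
  (* A positive value would bound the visit sums at [t > r], which [visit_sum_unbounded] forbids. *)
  move: Kge; rewrite le_eqVlt => /predU1P[//|Kgt0]; exfalso.
  have := visit_sum_unbounded hf hp0 (ltac:(by rewrite t0 tlt1) : 0 < t < 1)
    (visit_sum_of_kneading hf hp0 t01 Kgt0 nd).
  by rewrite -ltr_pdivlMr ?expR_gt0// mul1r -expRN ltNge (ltW rt).
have [kb _] := kneading_psum p0 (ltac:(by rewrite lexx ltr01) : 0 <= (0 : R) < 1).
have /eqP := psum_eq0_coef0 kb rt1 (expR_gt0 _) r1
  (fun t t01 tr => etrans (esym (kneading_psum p0 t01).2) (K0 t t01 tr)).
by rewrite /= oner_eq0.
Unshelve. all: by end_near. Qed.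

End Perturbation.

(** * Reflection of the interval *)

Section Reflection.
Variables (R : realType) (a b C c : R) (f0 f1 : R -> R).
Hypothesis hf : expanding_pair a b C c f0 f1.

Let g0 x := 1 - f1 (1 - x).
Let g1 x := 1 - f0 (1 - x).

Lemma expanding_pair_reflect : expanding_pair (1 - b) (1 - a) C c g0 g1.
Proof.
have [f00 f0b f0E] := ep_f0 hf; have [f1a f11 f1E] := ep_f1 hf.
split; [|by rewrite lerB// (ep_ab hf)| |exact: ep_c hf|exact: ep_C hf| |].
- by rewrite subr_gt0 (ep_b hf).
- by rewrite gtrBl (ep_a hf).
- split; [by rewrite /g0 subr0 f11 subrr|by rewrite /g0 subKr f1a subr0|].
  move=> x y x0 xy ya; have := f1E (1 - y) (1 - x) (ltac:(lra)) (ltac:(lra)) (ltac:(lra)).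
  by rewrite /g0; move=> /andP[]; lra.
- split; [by rewrite /g1 subKr f0b subrr|by rewrite /g1 subrr f00 subr0|].
  move=> x y x0 xy ya; have := f0E (1 - y) (1 - x) (ltac:(lra)) (ltac:(lra)) (ltac:(lra)).
  by rewrite /g1; move=> /andP[]; lra.
Qed.

(** Reflection exchanges upper and lower maps, but [cut] sees only the branches on the two sides of
    [p]. *)
Lemma lap_number_reflect p n u v : a <= p <= b -> sub01 u v ->
  lap_number g0 g1 (1 - p) n u v = lap_number f0 f1 p n (1 - v) (1 - u).
Proof.
move=> hp; have hp' : 1 - b <= 1 - p <= 1 - a by case/andP: hp => *; apply/andP; split; lra.
have hg := expanding_pair_reflect.
elim: n u v => [//|n IH] u v uv; have /and3P[u0 ult v1] := uv.
rewrite /lap_number !iterS -!/(lap_number _ _ _ n).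
case: cutP => [vp|pu|up pv].
- rewrite cut_right ?IH ?(sub01_left hg hp' uv vp)//; [|lra|lra].
  by rewrite /g0 !subKr.
- rewrite cut_left ?IH ?(sub01_right hg hp' uv pu)//; last lra.
  by rewrite /g1 !subKr.
- rewrite cut_mid ?IH ?(sub01_midl hg hp' u0 up) ?(sub01_midr hg hp' pv v1)//; [|lra|lra].
  by rewrite /g0 /g1 !subKr addrC.
Qed.

Lemma entropy_reflect p : a <= p <= b -> entropy g0 g1 (1 - p) = entropy f0 f1 p.
Proof.
move=> hp; rewrite /entropy; congr growth; apply/funext => n.
by rewrite lap_number_reflect ?sub01_01// subrr subr0.
Qed.

End Reflection.

(** The estimates on the right of [p0] are those on the left of [1 - p0] for the reflected pair. *)
Lemma entropy_continuous (R : realType) (a b C c : R) (f0 f1 : R -> R) (p0 e : R) :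
  expanding_pair a b C c f0 f1 -> a <= p0 <= b -> 0 < e ->
  exists2 d, 0 < d & forall p, a <= p <= b -> `|p0 - p| < d ->
    `|entropy f0 f1 p0 - entropy f0 f1 p| < e.
Proof.
move=> hf hp0 e0; have hg := expanding_pair_reflect hf.
have hp0' : 1 - b <= 1 - p0 <= 1 - a by case/andP: hp0 => *; apply/andP; split; lra.
have E0 := entropy_reflect hf hp0.
have hl : entropy f0 f1 p0 - e < entropy f0 f1 p0 by rewrite gtrBl.
have hr : entropy f0 f1 p0 < entropy f0 f1 p0 + e by rewrite ltrDl.
have [d1 d10 H1] := entropy_left_lsc hf hp0 hl.
have [d2 d20 H2] := entropy_left_usc hf hp0 hr.
rewrite -E0 in hl hr.
have [d3 d30 H3] := entropy_left_lsc hg hp0' hl.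
have [d4 d40 H4] := entropy_left_usc hg hp0' hr.
exists (Num.min (Num.min d1 d2) (Num.min d3 d4)); first by rewrite !lt_min d10 d20 d30.
move=> p hp; rewrite !lt_min => /andP[/andP[h1 h2] /andP[h3 h4]].
have /andP[ap pb] := hp.
have [pp0|p0p|->] := ltgtP p p0; last by rewrite subrr normr0.
- move: h1 h2; rewrite ger0_norm ?subr_ge0 ?(ltW pp0)// => h1 h2.
  by have := H1 p ap pp0 h1; have := H2 p ap pp0 h2; rewrite ltr_norml; lra.
- move: h3 h4; rewrite ler0_norm ?subr_le0 ?(ltW p0p)// opprB => h3 h4.
  have e1 : 1 - p < 1 - p0 by lra.
  have e2 : 1 - b <= 1 - p by lra.
  have e3 : 1 - p0 - (1 - p) = p - p0 by ring.
  have := H3 _ e2 e1; have := H4 _ e2 e1; rewrite e3 => /(_ h4) + /(_ h3).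
  by rewrite (entropy_reflect hf hp) ltr_norml; lra.
Qed.

(** * Total variation of iterates *)

Section TotalVariation.
Variable R : realType.
Implicit Types (f g h k : R -> R) (u v : R).
Local Notation TV := total_variation.

(** The increasing [f] carries each partition of the source to a partition of the target with the
    same variation. *)
Lemma total_variation_comp_le u v f g h :
  (forall x y, u <= x -> x < y -> y <= v -> f x < f y) ->
  (forall x, u <= x -> x <= v -> h x = g (f x)) ->
  (TV u v h <= TV (f u) (f v) g)%E.
Proof.
move=> fi hE; apply: ge_ereal_sup => _ [_ [s us <-] <-].
apply: ereal_sup_ubound; exists (variation (f u) (f v) g (map f s)).
  apply: variations_variation; case: us => us /eqP sv; split; last by rewrite last_map sv.
  elim: s u us sv fi {hE} => //= x s IH u /andP[ux xs] xv fi.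
  have xv' : x <= v by apply: (@itv_partition_le _ _ _ _ s); split; rewrite ?xv.
  rewrite fi//=; apply: IH => // y z xy; apply: fi; exact: le_trans (ltW ux) xy.
congr EFin; rewrite /variation size_map !big_nat; apply: eq_bigr => n /andP[_ ns] /=.
have nthE m : nth (f v) (f u :: map f s) m = f (nth v (u :: s) m).
  case: m => //= m; have [ms|ms] := ltnP m (size s); first exact: nth_map.
  by rewrite !nth_default ?size_map.
rewrite -[nth _ (map f s) n]/(nth (f v) (f u :: map f s) n.+1) !nthE !hE//.
- by apply: itv_partition_nth_ge us; exact: ltnW.
- by apply: itv_partition_nth_le us; exact: ltnW.
- exact: (@itv_partition_nth_ge _ _ u v s n.+1).
- exact: (@itv_partition_nth_le _ _ u v s n.+1).
Qed.

Lemma total_variation_step u v s h : u <= v ->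
  {in `[u, v] &, {homo h : x y / x <= y}} -> 0 <= h u -> h v <= 1 ->
  (TV u v (fun x => s * h x)%R <= `|s|%:E)%E.
Proof.
move=> uv hn hu hv.
wlog s0 : s / 0 <= s => [H|].
  have [/H//|/ltW s0] := leP 0 s.
  rewrite -total_variationN -normrN; have -> : \- (fun x => s * h x) = (fun x => - s * h x).
    by apply/funext => x; rewrite /= mulNr.
  by apply: H; rewrite oppr_ge0.
rewrite nondecreasing_total_variation// => [|x y xi yi xy]; last by rewrite ler_wpM2l// hn.
by rewrite lee_fin ger0_norm// -mulrBr ler_piMr//; lra.
Qed.

(** Such a [g] is a translate of the identity plus one jump at each end; each of the three varies by
    at most 1. *)
Lemma total_variation_id_inside u v g : 0 <= u -> u < v -> v <= 1 ->
  (forall x, u < x -> x < v -> g x = x) ->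
  (forall x, u <= x -> x <= v -> 0 <= g x <= 1) -> (TV u v g <= 3%:E)%E.
Proof.
move=> u0 uv v1 gE g01.
pose s0 := u - g u.
pose su x : R := (u < x)%R%:R; pose sv x : R := (v <= x)%R%:R.
have sub (P : R -> bool) : {homo (fun x => (P x)%:R : R) : x y / x <= y} ->
    {in `[u, v] &, {homo (fun x => (P x)%:R : R) : x y / x <= y}}.
  by move=> H x y _ _; exact: H.
have su_nd : {in `[u, v] &, {homo su : x y / x <= y}}.
  apply: sub => x y xy; rewrite ler_nat; case: (ltP u x) => // ux.
  by rewrite (lt_le_trans ux xy).
have sv_nd : {in `[u, v] &, {homo sv : x y / x <= y}}.
  apply: sub => x y xy; rewrite ler_nat; case: (leP v x) => // vx.
  by rewrite (le_trans vx xy).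
have b (x : bool) : 0 <= (x%:R : R) <= 1 by case: x; rewrite lexx ler01.
have uv' := ltW uv.
have T0 := @total_variation_step u v s0 su uv' su_nd (ltac:(by case/andP: (b (u < u)))) (ltac:(by case/andP: (b (u < v)))).
pose s2 := g v - v.
have T1 := @total_variation_step u v s2 sv uv' sv_nd (ltac:(by case/andP: (b (v <= u)))) (ltac:(by case/andP: (b (v <= v)))).
have T2 : TV u v (fun x => x - s0) = (v - u)%:E.
  by rewrite nondecreasing_total_variation//; [congr EFin; ring|move=> x y _ _ xy; rewrite lerD2r].
pose k : R -> R := ((fun x => x - s0) \+ (fun x => s0 * su x)) \+ (fun x => s2 * sv x).
have T3 : (TV u v k <= 3%:E)%E.
  apply: le_trans (total_variation_le _ _ uv') _.
  apply: (@le_trans _ _ ((v - u)%:E + `|s0|%:E + `|s2|%:E)%E).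
    apply: leeD => //; apply: le_trans (total_variation_le _ _ uv') _.
    by apply: leeD => //; rewrite T2.
  rewrite -!EFinD lee_fin.
  have := g01 u (lexx _) uv'; have := g01 v uv' (lexx _) => gv gu.
  have : `|s0| <= 1 by rewrite ler_norml /s0; lra.
  have : `|s2| <= 1 by rewrite ler_norml /s2; lra.
  lra.
apply: le_trans T3; apply: (@total_variation_comp_le _ _ id) => // x ux xv.
rewrite /k /= /su /sv /s0 /s2.
move: ux; rewrite le_eqVlt => /predU1P[<-|ux]; first by rewrite ltxx leNgt uv /= !mulr0n; ring.
move: xv; rewrite le_eqVlt => /predU1P[->|xv]; first by rewrite uv lexx !mulr1n; ring.
by rewrite ux leNgt xv gE//= mulr1n mulr0n; ring.
Qed.

Lemma strictly_increasing_inverse u v f :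
  (forall x y, u <= x -> x < y -> y <= v -> f x < f y) ->
  (forall y, f u <= y <= f v -> exists2 x, u <= x <= v & f x = y) ->
  exists k, [/\ forall x, u <= x <= v -> k (f x) = x,
    forall y, f u <= y <= f v -> u <= k y <= v /\ f (k y) = y &
    forall x y, f u <= x -> x < y -> y <= f v -> k x < k y].
Proof.
move=> fi fs.
have [k Hk] : exists k, forall y, f u <= y <= f v -> u <= k y <= v /\ f (k y) = y.
  have /choice[k Hk] : forall y, exists x, f u <= y <= f v -> u <= x <= v /\ f x = y.
    move=> y; have [/fs[x xuv fx]|_] := boolP (f u <= y <= f v); first by exists x.
    by exists 0.
  by exists k.
have fle x y : u <= x -> x <= y -> y <= v -> f x <= f y.
  by move=> ux; rewrite le_eqVlt => /predU1P[->//|xy] yv; rewrite ltW ?fi.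
exists k; split => //.
- move=> x /andP[ux xv]; have [|/andP[h1 h2] h3] := Hk (f x); first by rewrite !fle.
  case: (ltgtP (k (f x)) x) => // h; [have := fi _ _ h1 h xv|have := fi _ _ ux h h2];
    by rewrite h3 ltxx.
- move=> x y ux xy yv.
  have [/andP[h1 h2] h3] := Hk x (ltac:(by rewrite ux ltW// (lt_le_trans xy))).
  have [/andP[h4 h5] h6] := Hk y (ltac:(by rewrite yv (le_trans ux (ltW xy)))).
  by rewrite ltNge; apply/negP => yx; have := fle _ _ h4 yx h2; rewrite h3 h6 leNgt xy.
Qed.

End TotalVariation.

(** * Variation of the iterates and laps, for any value of the map at [p] *)

Section LapVariation.
Variables (R : realType) (a b C c p : R) (f0 f1 T : R -> R).
Hypothesis hf : expanding_pair a b C c f0 f1.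
Hypothesis hp : a <= p <= b.
Hypothesis f0_onto : forall y, 0 <= y <= 1 -> exists2 x, 0 <= x <= b & f0 x = y.
Hypothesis f1_onto : forall y, 0 <= y <= 1 -> exists2 x, a <= x <= 1 & f1 x = y.
Hypothesis T_left : forall x, 0 <= x -> x < p -> T x = f0 x.
Hypothesis T_right : forall x, p < x -> x <= 1 -> T x = f1 x.
Local Notation TV := total_variation.
Local Notation laps := (lap_number f0 f1 p).
Local Notation lens := (lap_length f0 f1 p).

Let inverse0 u v : 0 <= u -> u < v -> v <= p ->
  exists k, [/\ forall x, u <= x <= v -> k (f0 x) = x,
    forall y, f0 u <= y <= f0 v -> u <= k y <= v /\ f0 (k y) = y &
    forall x y, f0 u <= x -> x < y -> y <= f0 v -> k x < k y].
Proof.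
move=> u0 uv vp; have up := le_trans (ltW uv) vp; have v0 := le_trans u0 (ltW uv).
apply: strictly_increasing_inverse => [x y ux xy yv|y /andP[uy yv]].
  by apply: (f0_lt hf hp) => //; [exact: le_trans ux|exact: le_trans yv vp].
have [_ _ f0E] := ep_f0 hf; have /andP[_ pb] := hp.
(* The preimage given by [f0_onto] might lie on the right of [p], so monotonicity is needed on the
   whole branch. *)
have inj x z : 0 <= x -> x < z -> z <= b -> f0 x < f0 z.
  move=> x0 xz zb; have /andP[+ _] := f0E x z x0 (ltW xz) zb; have := ep_c hf => c1.
  have : 0 < c * (z - x) by rewrite mulr_gt0// ?subr_gt0// (lt_trans ltr01).
  lra.
have /andP[h1 _] := f0_01 hf hp u0 up; have /andP[_ h2] := f0_01 hf hp v0 vp.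
have [x /andP[x0 xb] xy] := f0_onto (ltac:(by rewrite (le_trans h1)// (le_trans yv)) : 0 <= y <= 1).
exists x => //; rewrite -xy in uy yv; apply/andP; split; rewrite leNgt; apply/negP => hx.
- by have := inj x u x0 hx (le_trans up pb); rewrite ltNge uy.
- by have := inj v x v0 hx xb; rewrite ltNge yv.
Qed.

Let inverse1 u v : p <= u -> u < v -> v <= 1 ->
  exists k, [/\ forall x, u <= x <= v -> k (f1 x) = x,
    forall y, f1 u <= y <= f1 v -> u <= k y <= v /\ f1 (k y) = y &
    forall x y, f1 u <= x -> x < y -> y <= f1 v -> k x < k y].
Proof.
move=> pu uv v1; have u1 := le_trans (ltW uv) v1; have pv := le_trans pu (ltW uv).
apply: strictly_increasing_inverse => [x y ux xy yv|y /andP[uy yv]].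
  by apply: (f1_lt hf hp) => //; [exact: le_trans pu ux|exact: le_trans yv v1].
have [_ _ f1E] := ep_f1 hf; have /andP[ap _] := hp.
have inj x z : a <= x -> x < z -> z <= 1 -> f1 x < f1 z.
  move=> x0 xz zb; have /andP[+ _] := f1E x z x0 (ltW xz) zb; have := ep_c hf => c1.
  have : 0 < c * (z - x) by rewrite mulr_gt0// ?subr_gt0// (lt_trans ltr01).
  lra.
have /andP[h1 _] := f1_01 hf hp pu u1; have /andP[_ h2] := f1_01 hf hp pv v1.
have [x /andP[xa x1] xy] := f1_onto (ltac:(by rewrite (le_trans h1)// (le_trans yv)) : 0 <= y <= 1).
exists x => //; rewrite -xy in uy yv; apply/andP; split; rewrite leNgt; apply/negP => hx.
- by have := inj x u xa hx u1; rewrite ltNge uy.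
- by have := inj v x (le_trans ap pv) hx x1; rewrite ltNge yv.
Qed.

(* The values of [g] at the endpoints are left free because the branch of [T]
   applied there need not be the one used inside the interval. *)
Lemma total_variation_le_laps n u v g : sub01 u v ->
  (forall x, u < x -> x < v -> g x = iter n T x) ->
  (forall x, u <= x -> x <= v -> 0 <= g x <= 1) ->
  (TV u v g <= (3 * laps n u v)%:E)%E.
Proof.
elim: n u v g => [|n IH] u v g uv gE g01; have /and3P[u0 ult v1] := uv.
  by rewrite mulr1; apply: total_variation_id_inside.
have left u' v' : u <= u' -> u' < v' -> v' <= v -> v' <= p ->
    (TV u' v' g <= (3 * laps n (f0 u') (f0 v'))%:E)%E.
  move=> uu' uv' vv' vp'; have u'0 := le_trans u0 uu'.
  have [k [kf fk ki]] := inverse0 u'0 uv' vp'.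
  have sub' : sub01 u' v' by rewrite /sub01 u'0 uv' (le_trans vv').
  apply: (@le_trans _ _ (TV (f0 u') (f0 v') (g \o k))).
    apply: total_variation_comp_le => [x y ux xy yv|x ux xv] /=; last by rewrite kf ?ux.
    by apply: (f0_lt hf hp) => //; [exact: le_trans ux|exact: le_trans vp'].
  apply: IH => [|y uy yv|y uy yv]; first exact: (sub01_left hf hp).
  - have [/andP[h1 h2] h3] := fk y (ltac:(by rewrite !ltW)).
    (* Interior points must come from interior points, where both [g] and the branch of [T] are
       known. *)
    have h1' : u' < k y.
      by rewrite lt_neqAle h1 andbT; apply: contraTneq uy => ->; rewrite h3 ltxx.
    have h2' : k y < v'.
      by rewrite lt_neqAle h2 andbT; apply: contraTneq yv => <-; rewrite h3 ltxx.
    rewrite /= gE; [|exact: le_lt_trans h1'|exact: lt_le_trans vv'].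
    rewrite iterSr T_left ?h3//; first exact: le_trans h1.
    exact: lt_le_trans h2' vp'.
  - have [/andP[h1 h2] h3] := fk y (ltac:(by rewrite uy)).
    by apply: g01; [exact: le_trans h1|exact: le_trans vv'].
have right u' v' : u <= u' -> u' < v' -> v' <= v -> p <= u' ->
    (TV u' v' g <= (3 * laps n (f1 u') (f1 v'))%:E)%E.
  move=> uu' uv' vv' pu'; have v'1 := le_trans vv' v1.
  have [k [kf fk ki]] := inverse1 pu' uv' v'1.
  have sub' : sub01 u' v' by rewrite /sub01 (le_trans u0 uu') uv' v'1.
  apply: (@le_trans _ _ (TV (f1 u') (f1 v') (g \o k))).
    apply: total_variation_comp_le => [x y ux xy yv|x ux xv] /=; last by rewrite kf ?ux.
    by apply: (f1_lt hf hp) => //; [exact: le_trans ux|exact: le_trans v'1].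
  apply: IH => [|y uy yv|y uy yv]; first exact: (sub01_right hf hp).
  - have [/andP[h1 h2] h3] := fk y (ltac:(by rewrite !ltW)).
    have h1' : u' < k y.
      by rewrite lt_neqAle h1 andbT; apply: contraTneq uy => ->; rewrite h3 ltxx.
    have h2' : k y < v'.
      by rewrite lt_neqAle h2 andbT; apply: contraTneq yv => <-; rewrite h3 ltxx.
    rewrite /= gE; [|exact: le_lt_trans h1'|exact: lt_le_trans vv'].
    rewrite iterSr T_right ?h3//; first exact: le_lt_trans h1'.
    exact: le_trans h2 v'1.
  - have [/andP[h1 h2] h3] := fk y (ltac:(by rewrite uy)).
    by apply: g01; [exact: le_trans h1|exact: le_trans vv'].
rewrite /lap_number iterS -/(laps n); case: cutP => [vp|pu|up pv].
- exact: left.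
- exact: right.
- rewrite (total_variationD _ (ltW up) (ltW pv)) mulrDr EFinD; apply: leeD.
  + by apply: left => //; exact: ltW.
  + by apply: right => //; exact: ltW.
Qed.

(** The value of [T] at [p] being arbitrary, variation is collected on intervals that avoid the
    endpoints, at the cost of [e]. *)
Lemma lap_length_le_total_variation n u v e : sub01 u v -> 0 < e ->
  exists u' v', [/\ u < u', u' <= v', v' < v &
    ((lens n u v - e)%:E <= TV u' v' (iter n T))%E].
Proof.
elim: n u v e => [|n IH] u v e uv e0; have /and3P[u0 ult v1] := uv.
  pose d := Num.min (e / 2) ((v - u) / 3).
  have d1 : d <= e / 2 by rewrite ge_min lexx.
  have d2 : d <= (v - u) / 3 by rewrite ge_min lexx orbT.
  have d0 : 0 < d by rewrite lt_min !divr_gt0// subr_gt0.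
  exists (u + d), (v - d).
  have uv' : u + d <= v - d by lra.
  split; [lra|exact: uv'|lra|].
  apply: le_trans (total_variation_ge _ uv'); rewrite lee_fin /lap_length /=.
  by apply: le_trans (ler_norm _); lra.
have left u' v' e' : u <= u' -> u' < v' -> v' <= v -> v' <= p -> 0 < e' ->
    exists u2 v2, [/\ u' < u2, u2 <= v2, v2 < v' &
    ((lens n (f0 u') (f0 v') - e')%:E <= TV u2 v2 (iter n.+1 T))%E].
  move=> uu' uv' vv' vp' e'0; have u'0 := le_trans u0 uu'.
  have [k [kf fk ki]] := inverse0 u'0 uv' vp'.
  have sub' : sub01 u' v' by rewrite /sub01 u'0 uv' (le_trans vv').
  have [y1 [y2 [uy1 y12 y2v Hy]]] := IH _ _ _ (sub01_left hf hp sub' vp') e'0.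
  have [fu' fv'] : u' = k (f0 u') /\ v' = k (f0 v') by rewrite !kf ?lexx ?(ltW uv').
  have k2 : k y2 < v' by rewrite fv' ki// (le_trans (ltW uy1)).
  exists (k y1), (k y2); split => //.
  - by rewrite fu' ki ?lexx ?kf ?lexx ?(ltW uv')// (le_trans y12 (ltW y2v)).
  - move: y12; rewrite le_eqVlt => /predU1P[->//|y12].
    by rewrite ltW// ki// ltW.
  apply: le_trans Hy _; apply: total_variation_comp_le => [x y xy1 xy yy2|x xy1 xy2].
    by apply: ki => //; [exact: le_trans (ltW uy1) xy1|exact: le_trans yy2 (ltW y2v)].
  have xv := le_lt_trans xy2 y2v; have ux := lt_le_trans uy1 xy1.
  have [/andP[h1 h2] h3] := fk x (ltac:(by rewrite !ltW)).
  rewrite iterSr T_left ?h3//; first exact: le_trans h1.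
  by apply: lt_le_trans vp'; rewrite [ltRHS]fv' ki// ltW.
have right u' v' e' : u <= u' -> u' < v' -> v' <= v -> p <= u' -> 0 < e' ->
    exists u2 v2, [/\ u' < u2, u2 <= v2, v2 < v' &
    ((lens n (f1 u') (f1 v') - e')%:E <= TV u2 v2 (iter n.+1 T))%E].
  move=> uu' uv' vv' pu' e'0; have v'1 := le_trans vv' v1.
  have [k [kf fk ki]] := inverse1 pu' uv' v'1.
  have sub' : sub01 u' v' by rewrite /sub01 (le_trans u0 uu') uv' v'1.
  have [y1 [y2 [uy1 y12 y2v Hy]]] := IH _ _ _ (sub01_right hf hp sub' pu') e'0.
  have [fu' fv'] : u' = k (f1 u') /\ v' = k (f1 v') by rewrite !kf ?lexx ?(ltW uv').
  have k2 : k y2 < v' by rewrite fv' ki// (le_trans (ltW uy1)).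
  exists (k y1), (k y2); split => //.
  - by rewrite fu' ki ?lexx ?kf ?lexx ?(ltW uv')// (le_trans y12 (ltW y2v)).
  - move: y12; rewrite le_eqVlt => /predU1P[->//|y12].
    by rewrite ltW// ki// ltW.
  apply: le_trans Hy _; apply: total_variation_comp_le => [x y xy1 xy yy2|x xy1 xy2].
    by apply: ki => //; [exact: le_trans (ltW uy1) xy1|exact: le_trans yy2 (ltW y2v)].
  have xv := le_lt_trans xy2 y2v; have ux := lt_le_trans uy1 xy1.
  have [/andP[h1 h2] h3] := fk x (ltac:(by rewrite !ltW)).
  rewrite iterSr T_right ?h3//; last exact: le_trans h2 v'1.
  by apply: le_lt_trans pu' _; rewrite [ltLHS]fu' ki// ltW.
rewrite /lap_length iterS -/(lens n); case: cutP => [vp|pu|up pv].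
- exact: left.
- exact: right.
have e2 : 0 < e / 2 by rewrite divr_gt0.
have [u1 [v2 [h1 h2 h3 h4]]] := left u p _ (lexx _) up (ltW pv) (lexx _) e2.
have [u3 [v4 [k1 k2 k3 k4]]] := right p v _ (ltW up) pv (lexx _) (lexx _) e2.
have v2u3 : v2 <= u3 := ltW (lt_trans h3 k1).
exists u1, v4; split => //; first exact: le_trans h2 (le_trans v2u3 k2).
(* The gap between the two intervals can only add variation. *)
rewrite (total_variationD _ h2 (le_trans v2u3 k2)) (total_variationD _ v2u3 k2).
have -> : forall x y : R, x + y - e = (x - e / 2) + (y - e / 2) by move=> x y; field.
rewrite EFinD; apply: leeD => //; apply: le_trans k4 _.
by rewrite leeDr// total_variation_ge0.
Qed.

Hypothesis T_p : 0 <= T p <= 1.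

Lemma iter_T01 n x : 0 <= x <= 1 -> 0 <= iter n T x <= 1.
Proof.
move=> x01; elim: n => //= n; move: (iter n T x) => y /andP[y0 y1].
have [yp|py|->//] := ltgtP y p.
- by rewrite T_left//; apply: (f0_01 hf hp) => //; exact: ltW.
- by rewrite T_right//; apply: (f1_01 hf hp) => //; exact: ltW.
Qed.

Lemma total_variation_iter n : exists V, [/\ TV 0 1 (iter n T) = V%:E,
  lens n 0 1 <= V & V <= 3 * laps n 0 1].
Proof.
have up : (TV 0 1 (iter n T) <= (3 * laps n 0 1)%:E)%E.
  apply: total_variation_le_laps => //; first exact: sub01_01.
  by move=> x x0 x1; apply: iter_T01; rewrite x0.
have lo : ((lens n 0 1)%:E <= TV 0 1 (iter n T))%E.
  apply/lee_addgt0Pr => e e0.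
  have [u [v [u0 uv v1 H]]] := lap_length_le_total_variation n (sub01_01 R) e0.
  rewrite -leeBlDr// -EFinB; apply: le_trans H _.
  rewrite (total_variationD _ (ltW u0) (le_trans uv (ltW v1))).
  rewrite (total_variationD _ uv (ltW v1)).
  apply: le_trans (_ : TV u v (iter n T) + TV v 1 (iter n T) <= _)%E.
    by rewrite leeDl// total_variation_ge0// ltW.
  by rewrite leeDr// total_variation_ge0// ltW.
move: up lo; case: (TV 0 1 (iter n T)) => [V| |]; rewrite ?leye_eq ?leeNy_eq// !lee_fin.
by exists V.
Qed.

(** By [lap_number_le_length] the variation is at least the lap number divided by [A], and it is at
    most 3 times the lap number; constant factors disappear when the logarithm is divided by [n]. *)
Lemma log_variation_rate_cvg :
  log_variation_rate T @ \oo --> (entropy f0 f1 p)%:E.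
Proof.
have [A A0 HA] := lap_number_le_length hf hp.
have L1 n : 1 <= laps n 0 1 := lap_number_ge1 hf hp n (sub01_01 R).
have L0 n : 0 < laps n 0 1 := lt_le_trans ltr01 (L1 n).
have /choice[V HV] := total_variation_iter.
have V0 n : 0 < V n.
  have [_ + _] := HV n; apply: lt_le_trans; rewrite -(pmulr_rgt0 _ A0).
  exact: lt_le_trans (HA n).
have -> : log_variation_rate T = (fun n => (n%:R^-1 * ln (V n))%:E).
  by apply/funext => n; rewrite /log_variation_rate; have [-> _ _] := HV n; rewrite lne_EFin.
apply: cvg_EFin; first by near=> n.
have cL : (fun n => n%:R^-1 * ln (laps n 0 1)) @ \oo --> entropy f0 f1 p.
  apply: growth_cvg => [n|m n]; first exact: (ln_lap_number_ge0 hf hp).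
  exact: (ln_lap_numberD hf hp).
have c0 (k : R) : (fun n : nat => n%:R^-1 * k) @ \oo --> (0 : R).
  rewrite -(mul0r k); apply: cvgMl.
  by rewrite -(cvg_shiftS (fun n => (n%:R : R)^-1)); exact: cvg_harmonic.
apply: (@squeeze_cvgr _ _ _ _ (fun n => n%:R^-1 * ln (laps n 0 1) - n%:R^-1 * ln A)
   (fun n => n%:R^-1 * ln (laps n 0 1) + n%:R^-1 * ln 3)).
- near=> n; rewrite -mulrBr -mulrDr; have [_ h1 h2] := HV n.
  rewrite !ler_wpM2l ?invr_ge0//.
  + by rewrite addrC -lnM ?posrE// ler_ln ?posrE// mulr_gt0.
  + rewrite lerBlDl -lnM ?posrE// ler_ln ?posrE ?mulr_gt0//.
    by apply: le_trans (HA n) _; rewrite ler_wpM2l// ltW.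
- by rewrite -[X in _ --> X]subr0; apply: cvgB.
- by rewrite -[X in _ --> X]addr0; apply: cvgD.
Unshelve. all: by end_near. Qed.

End LapVariation.

(** * Branch functions as expanding pairs, and continuity of the entropy *)

Lemma expanding_of_increasing_surjection (R : realType) (C c u v : R) (f : R -> R) :
  u <= v -> 1 < C -> 1 < c -> increasing_surjection u v f -> inverse_bounds C c u v f ->
  expanding C c u v f /\ forall y, 0 <= y <= 1 -> exists2 x, u <= x <= v & f x = y.
Proof.
move=> uv C1 c1 [ffun fsurj _ finc] fb.
have C0 : 0 < C := lt_trans ltr01 C1.
have c0 : 0 < c := lt_trans ltr01 c1.
have f01 x : u <= x <= v -> 0 <= f x <= 1.
  by move=> xuv; have := ffun x; rewrite /= !in_itv /= => /(_ xuv).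
have flt x y : u <= x -> x < y -> y <= v -> f x < f y.
  move=> ux xy yv; apply: finc => //; rewrite in_itv /=.
    by rewrite ux (le_trans (ltW xy)).
  by rewrite yv (le_trans ux (ltW xy)).
have onto y : 0 <= y <= 1 -> exists2 x, u <= x <= v & f x = y.
  move=> y01; have := fsurj y; rewrite /= in_itv /= => /(_ y01)[x].
  by rewrite /= in_itv /= => xuv <-; exists x.
have /andP[fu0 _] := f01 u (ltac:(by rewrite lexx)).
have /andP[_ fv1] := f01 v (ltac:(by rewrite lexx uv)).
split=> //; split.
- have [x /andP[ux xv] fx] := onto 0 (ltac:(by rewrite lexx ler01)).
  move: ux; rewrite le_eqVlt => /predU1P[->//|ux].
  by have := flt _ _ (lexx u) ux xv; rewrite fx ltNge fu0.
- have [x /andP[ux xv] fx] := onto 1 (ltac:(by rewrite lexx ler01)).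
  move: xv; rewrite le_eqVlt => /predU1P[<-//|xv].
  by have := flt _ _ ux xv (lexx v); rewrite fx ltNge fv1.
(* Injectivity makes [pinv] a left inverse, so the bounds at [f x] and [f y] compare [y - x] with
   [f y - f x]. *)
- have inj : {in `[u, v]%classic &, injective f}.
    move=> x y; rewrite !inE /= !in_itv /= => /andP[ux xv] /andP[uy yv] fxy.
    case: (ltgtP x y) => // xy; [have := flt _ _ ux xy yv|have := flt _ _ uy xy xv];
      by rewrite fxy ltxx.
  move=> x y ux xy yv; have xuv : u <= x <= v by rewrite ux (le_trans xy).
  have yuv : u <= y <= v by rewrite yv (le_trans ux).
  have pK z : u <= z <= v -> pinv `[u, v]%classic f (f z) = z.
    by move=> zuv; apply: (pinvKV _ inj); rewrite inE /= in_itv.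
  have := fb (f y) (f x); rewrite !in_itv /= !f01// => /(_ isT isT).
  rewrite !pK//.
  have fxy : f x <= f y.
    by move: xy; rewrite le_eqVlt => /predU1P[->//|xy]; rewrite ltW// flt.
  rewrite !ger0_norm ?subr_ge0// => /andP[].
  rewrite mulrC ler_pdivrMr// => h1; rewrite mulrC ler_pdivlMr// => h2.
  by rewrite mulrC h2 mulrC h1.
Qed.

(** The first conjunct gives meaning to the second: the limits exist, [fine] is applied to finite
    values, and the upper map may stand for both. *)
Theorem theorem1p2 (R : realType) (a b : R) (f0 f1 : R -> R)
    (a_gt0 : 0 < a) (le_ab : a <= b) (b_lt1 : b < 1)
    (f01 : branch_functions a b f0 f1) :
  (forall p : R, p \in `[a, b] ->
     [/\ cvgn (log_variation_rate (upper_lorenz f0 f1 p)),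
         cvgn (log_variation_rate (lower_lorenz f0 f1 p)),
         topological_entropy (upper_lorenz f0 f1 p) \is a fin_num &
         topological_entropy (upper_lorenz f0 f1 p)
           = topological_entropy (lower_lorenz f0 f1 p)])
  /\ {within `[a, b], continuous
        (fun p : R => fine (topological_entropy (upper_lorenz f0 f1 p)))}.
Proof.
have [is0 is1 [C [c [C1 c1 ib0 ib1]]]] := f01.
have b0 : 0 <= b by apply: le_trans le_ab; exact: ltW.
have a1 : a <= 1 by apply: le_trans le_ab _; exact: ltW.
have [ex0 onto0] := expanding_of_increasing_surjection b0 C1 c1 is0 ib0.
have [ex1 onto1] := expanding_of_increasing_surjection a1 C1 c1 is1 ib1.
have hf : expanding_pair a b C c f0 f1 by [].
have cvg_upper p : a <= p <= b ->
    log_variation_rate (upper_lorenz f0 f1 p) @ \oo --> (entropy f0 f1 p)%:E.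
  move=> hp; apply: (log_variation_rate_cvg hf hp onto0 onto1) => [x _ xp|x px _|].
  - by rewrite /upper_lorenz xp.
  - by rewrite /upper_lorenz ltNge (ltW px).
  - by rewrite /upper_lorenz ltxx; apply: (f1_01 hf hp) => //; rewrite ltW// (p_lt1 hf hp).
have cvg_lower p : a <= p <= b ->
    log_variation_rate (lower_lorenz f0 f1 p) @ \oo --> (entropy f0 f1 p)%:E.
  move=> hp; apply: (log_variation_rate_cvg hf hp onto0 onto1) => [x _ xp|x px _|].
  - by rewrite /lower_lorenz (ltW xp).
  - by rewrite /lower_lorenz leNgt px.
  - by rewrite /lower_lorenz lexx; apply: (f0_01 hf hp) => //; rewrite ltW// (p_gt0 hf hp).
have entropy_upper p : a <= p <= b ->
    topological_entropy (upper_lorenz f0 f1 p) = (entropy f0 f1 p)%:E.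
  by move=> hp; apply/cvg_lim => //; exact: cvg_upper.
have entropy_lower p : a <= p <= b ->
    topological_entropy (lower_lorenz f0 f1 p) = (entropy f0 f1 p)%:E.
  by move=> hp; apply/cvg_lim => //; exact: cvg_lower.
split=> [p|].
  rewrite in_itv /= => hp; rewrite entropy_upper// entropy_lower//.
  by split=> //; apply: cvgP; [exact: cvg_upper|exact: cvg_lower].
apply/subspace_continuousP => p0; rewrite /= in_itv /= => hp0.
apply/cvgrPdist_lt => e e0.
have [d d0 Hd] := entropy_continuous hf hp0 e0.
rewrite near_withinE; exists d => // p /= pd; rewrite in_itv /= => hp.
by rewrite /from_subspace /= !entropy_upper//=; exact: Hd.
Qed.
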